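(* Let $K$ be a star body with continuous radial function in $\mathbb{R}^n$, $n\geq 3$, whose central sections (i.e. intersections with linear subspaces) are all completely symmetric. Then $K$ is an origin symmetric Euclidean ball.
   Context: A star body is a set which is star-shaped with respect to the origin and has non-empty interior; it is origin symmetric if $K=-K$. For a star body $K$ in $\mathbb{R}^n$ that contains the origin in its interior, the radial function $\rho_K:S^{n-1}\to\mathbb{R}_+$ is $\rho_K(u)=\sup\{t: tu\in K\}$, where $S^{n-1}$ is the unit sphere of $\mathbb{R}^n$. $ISO(n)$ denotes the group of all isometries of $\mathbb{R}^n$, and the symmetry group of a set $A\subseteq\mathbb{R}^n$ is $Sym(A)=\{T\in ISO(n):TA=A\}$. A subgroup $G$ of $ISO(n)$ is called complete if every ellipsoid whose symmetry group contains $G$ is a ball. A subset of $\mathbb{R}^n$ is called completely symmetric if its centroid is at the origin and its symmetry group is complete. For a section $K\cap H$ by a subspace $H$, these notions are understood within $H$ (identified with a Euclidean space of dimension $\dim H$).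
   Formalization: As star bodies are not assumed closed, K can differ from a ball on its boundary sphere; the conclusion proved is that for some r > 0 K contains the open ball of radius r about the origin and lies in the closed one, and equals the closed ball if K is closed. *)

(* Defs.v *)
From HB Require Import structures.
From mathcomp Require Import all_boot all_order all_algebra.
From mathcomp Require Import all_classical all_reals all_analysis.

Set Implicit Arguments.
Unset Strict Implicit.
Unset Printing Implicit Defensive.

Import Order.TTheory GRing.Theory Num.Theory.
Import numFieldNormedType.Exports.

Local Open Scope classical_set_scope.
Local Open Scope ring_scope.

(* R^n is 'rV[R]_n.  Its library norm is the sup norm, so the Euclidean norm
   is introduced separately; the two induce the same topology. *)
Definition enorm (R : realType) (n : nat) (x : 'rV[R]_n) : R :=
  Num.sqrt (\sum_(i < n) x 0 i ^+ 2).

Definition unit_sphere (R : realType) (n : nat) : set 'rV[R]_n :=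
  [set u | enorm u = 1].

Definition open_eball (R : realType) (n : nat) (c : 'rV[R]_n) (r : R)
  : set 'rV[R]_n := [set x | enorm (x - c) < r].

Definition closed_eball (R : realType) (n : nat) (c : 'rV[R]_n) (r : R)
  : set 'rV[R]_n := [set x | enorm (x - c) <= r].

Definition star_shaped (R : realType) (n : nat) (K : set 'rV[R]_n) : Prop :=
  forall x t, K x -> 0 <= t -> t <= 1 -> K (t *: x).

(* Closedness is not part of the definition: which boundary points belong to a
   star body is not visible in its radial function. *)
Definition star_body (R : realType) (n : nat) (K : set 'rV[R]_n) : Prop :=
  star_shaped K /\ K° !=set0.

Definition radial_function (R : realType) (n : nat) (K : set 'rV[R]_n)
  (u : 'rV[R]_n) : R := sup [set t : R | K (t *: u)].

(* The radial function is defined for bodies with the origin in the interior.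
   It is real-valued: [sup] of an unbounded set is 0 by convention, so the
   boundedness of the sets in question has to be required. *)
Definition has_continuous_radial_function (R : realType) (n : nat)
    (K : set 'rV[R]_n) : Prop :=
  [/\ K° 0,
      forall u, unit_sphere u -> has_ubound [set t : R | K (t *: u)] &
      {within @unit_sphere R n, continuous (radial_function K)}].

Definition ISO (R : realType) (n : nat) : set ('rV[R]_n -> 'rV[R]_n) :=
  [set T | forall x y, enorm (T x - T y) = enorm (x - y)].

Definition Sym (R : realType) (n : nat) (A : set 'rV[R]_n)
  : set ('rV[R]_n -> 'rV[R]_n) := [set T | ISO T /\ T @` A = A].

Definition ellipsoid (R : realType) (n : nat) (E : set 'rV[R]_n) : Prop :=
  exists (c : 'rV[R]_n) (M : 'M[R]_n),
    M \in unitmx /\ E = [set c + x *m M | x in closed_eball 0 1].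

Definition euclidean_ball (R : realType) (n : nat) (E : set 'rV[R]_n) : Prop :=
  exists (c : 'rV[R]_n) (r : R), 0 < r /\ E = closed_eball c r.

(* [G] ranges over arbitrary sets of maps; it is only applied to the symmetry
   groups [Sym A], which are subgroups of [ISO]. *)
Definition complete_group (R : realType) (n : nat)
    (G : set ('rV[R]_n -> 'rV[R]_n)) : Prop :=
  forall E, ellipsoid E -> G `<=` Sym E -> euclidean_ball E.

(* The Lebesgue measure of R^k (as a product measure), as a measure on k-tuples (which, unlike row
   vectors, carry the product sigma-algebra in the library). *)
Section lebesgue_tuple.
Variable R : realType.
Local Notation T := (measurableTypeR R).
Local Open Scope ereal_scope.

Definition cons_pair (k : nat) (p : T * k.-tuple T) : k.+1.-tuple T :=
  [tuple of p.1 :: p.2].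

Lemma measurable_cons_pair (k : nat) : measurable_fun setT (@cons_pair k).
Proof. exact: measurable_cons. Qed.

Definition lebesgue_cons (k : nat)
    (m : {sigma_finite_measure set (k.-tuple T) -> \bar R}) :
    set (k.+1.-tuple T) -> \bar R :=
  pushforward (@lebesgue_measure R \x m) (@cons_pair k).

Section lebesgue_cons_measure.
Variables (k : nat) (m : {sigma_finite_measure set (k.-tuple T) -> \bar R}).

Let mcons := @measurable_cons_pair k.

Let lebesgue_cons0 : lebesgue_cons m set0 = 0.
Proof. by rewrite /lebesgue_cons /pushforward preimage_set0 measure0. Qed.

Let lebesgue_cons_ge0 A : 0 <= lebesgue_cons m A.
Proof. exact: measure_ge0. Qed.

Let lebesgue_cons_sigma_additive : semi_sigma_additive (lebesgue_cons m).
Proof.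
move=> F mF tF mUF; rewrite /lebesgue_cons /pushforward preimage_bigcup.
apply: measure_semi_sigma_additive.
- by move=> i; rewrite -[X in measurable X]setTI; exact: mcons.
- apply/trivIsetP => i j _ _ ij; rewrite -preimage_setI.
  by move/trivIsetP : tF => ->//; rewrite preimage_set0.
- by rewrite -preimage_bigcup -[X in measurable X]setTI; exact: mcons.
Qed.

HB.instance Definition _ := isMeasure.Build _ _ _ (lebesgue_cons m)
  lebesgue_cons0 lebesgue_cons_ge0 lebesgue_cons_sigma_additive.

Let uncons (t : k.+1.-tuple T) : T * k.-tuple T :=
  (thead t, [tuple of behead t]).

Let cons_pairK : cancel (@cons_pair k) uncons.
Proof.
by case=> x t; rewrite /uncons /cons_pair theadE; congr pair; exact: val_inj.
Qed.

Let measurable_uncons : measurable_fun setT uncons.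
Proof.
apply/measurable_fun_pairP; split => /=.
  exact: (measurable_tnth ord0).
exact: measurable_behead.
Qed.

Let lebesgue_cons_sigma_finite : sigma_finite setT (lebesgue_cons m).
Proof.
have /sigma_finiteP[F [TF ndF Foo]] := sigma_finiteT (@lebesgue_measure R).
have /sigma_finiteP[G [TG ndG Goo]] := sigma_finiteT m.
exists (fun i => uncons @^-1` (F i `*` G i)).
  rewrite -preimage_bigcup (_ : \bigcup_i _ = setT) ?preimage_setT//.
  rewrite -setXTT TF TG predeqE => -[x y]; split.
    by move=> [i _ []/= ? ?]; split; exists i.
  move=> [/= [i _ Fix] [j _ Gjy]]; exists (maxn i j) => //; split.
  - by move: x Fix; exact/subsetPset/ndF/leq_maxl.
  - by move: y Gjy; exact/subsetPset/ndG/leq_maxr.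
move=> i; have [mF Fi] := Foo i; have [mG Gi] := Goo i; split.
  rewrite -[X in measurable X]setTI; apply: measurable_uncons => //.
  exact: measurableX.
rewrite /lebesgue_cons /pushforward -comp_preimage.
rewrite (_ : uncons \o _ = id); last first.
  by apply/funext => p; exact: cons_pairK.
by rewrite preimage_id product_measure1E// lte_mul_pinfty// ge0_fin_numE.
Qed.

HB.instance Definition _ := Measure_isSigmaFinite.Build _ _ _ (lebesgue_cons m)
  lebesgue_cons_sigma_finite.

End lebesgue_cons_measure.

Fixpoint lebesgue_tuple (k : nat) :
    {sigma_finite_measure set (k.-tuple T) -> \bar R} :=
  if k is k'.+1 then lebesgue_cons (lebesgue_tuple k') else dirac [tuple].

Lemma lebesgue_tuple_box (k : nat) (A : 'I_k -> set T) :
  (forall i, measurable (A i)) ->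
  lebesgue_tuple k [set t | forall i, A i (tnth t i)] =
  \prod_(i < k) lebesgue_measure (A i).
Proof.
elim: k A => [|k IH] A mA.
  by rewrite big_ord0 /= diracE mem_set// => -[].
rewrite big_ord_recl -IH; last by move=> i; exact: mA.
rewrite /= /lebesgue_cons /pushforward.
rewrite -product_measure1E//; last first.
  rewrite (_ : mkset _ =
    \bigcap_i (fun t : k.-tuple T => tnth t i) @^-1` A (lift ord0 i)).
    apply: fin_bigcap_measurable => // i _; rewrite -[X in measurable X]setTI.
    exact: measurable_tnth.
  by apply/seteqP; split=> t /= At i => [_|]; exact: At.
congr (_ _); apply/seteqP; split=> -[x t] /=.
  move=> Axt; split; first exact: (Axt ord0).
  by move=> i; have := Axt (lift ord0 i); rewrite /cons_pair tnthS.
move=> [Ax At] i; case: (unliftP ord0 i) => [j ->|->]//.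
by rewrite /cons_pair tnthS.
Qed.

End lebesgue_tuple.

Definition row_of_tuple (R : realType) (k : nat)
  (t : k.-tuple (measurableTypeR R)) : 'rV[R]_k := \row_(i < k) tnth t i.

Definition volume (R : realType) (k : nat) (A : set 'rV[R]_k) : \bar R :=
  (\int[lebesgue_tuple R k]_(t in @row_of_tuple R k @^-1` A) 1)%E.

Definition moment (R : realType) (k : nat) (A : set 'rV[R]_k) (i : 'I_k)
  : \bar R :=
  (\int[lebesgue_tuple R k]_(t in @row_of_tuple R k @^-1` A) (tnth t i)%:E)%E.

(* Integrals of non-measurable functions are lower integrals in the library;
   this only matters for sets that are not Borel, and gives the expected value
   when the boundary is a null set.  The equality on moments forces them to be
   finite. *)
Definition is_centroid (R : realType) (k : nat) (A : set 'rV[R]_k)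
    (c : 'rV[R]_k) : Prop :=
  [/\ (0 < volume A)%E, (volume A < +oo)%E &
      forall i, moment A i = ((c 0 i)%:E * volume A)%E].

Definition completely_symmetric (R : realType) (k : nat) (A : set 'rV[R]_k)
  : Prop := is_centroid A 0 /\ complete_group (Sym A).

Definition orthonormal_basis (R : realType) (n : nat)
    (H : {vspace 'rV[R]_n}) (B : 'M[R]_(\dim H, n)) : Prop :=
  B *m B^T = 1%:M /\ forall i, row i B \in H.

(* The section of K by H read in the coordinates of an orthonormal basis of H;
   x |-> x *m B is a linear isometry of R^(dim H) onto H. *)
Definition section_in_basis (R : realType) (n : nat) (K : set 'rV[R]_n)
    (H : {vspace 'rV[R]_n}) (B : 'M[R]_(\dim H, n)) : set 'rV[R]_(\dim H) :=
  [set x | (K `&` [set y | y \in H]) (x *m B)].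

(* Complete symmetry is invariant under isometries fixing the origin, so the
   choice of the orthonormal basis is immaterial. *)
Definition completely_symmetric_section (R : realType) (n : nat)
    (K : set 'rV[R]_n) (H : {vspace 'rV[R]_n}) : Prop :=
  forall B : 'M[R]_(\dim H, n), orthonormal_basis B ->
    completely_symmetric (section_in_basis K B).

(* Main.v *)
(* Let rho be the radial function of K.  The centroids of the one-dimensional
   sections being at the origin, rho is even.  The symmetries of a planar section
   are therefore linear, and since no ellipse other than a disc is invariant
   under all of them, one of them is a rotation other than the identity and the
   half-turn: on every great circle, rho has a period 2 pi / m with m >= 3.

   Suppose that rho is not constant on some great circle of a great 2-sphere.  The
   great circles of that sphere on which 2 pi / m is a period form a closed set, so
   by Baire's theorem some m works for all the great circles in a neighbourhood of
   a circle C on which rho is not constant.  Write th = 2 pi / m; then rho(x) =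
   rho(y) whenever x and y are at distance th and both close to the plane of C.
   Two nearby points x, x' of C are joined by a chain x, y, z, y', x' of such steps,
   where z is close to x in the bisector plane of x and x', and y, y' are mirror
   images of each other: y is obtained by turning x by th along a circle slightly
   tilted with respect to C.  Hence rho is locally constant on C, a
   contradiction. *)

From HB Require Import structures.
Require Import Defs.
From mathcomp Require Import all_boot all_order all_algebra.
From mathcomp Require Import all_classical all_reals all_analysis.
From mathcomp Require Import ring lra.

Set Implicit Arguments.
Unset Strict Implicit.
Unset Printing Implicit Defensive.

Import Order.TTheory GRing.Theory Num.Theory.
Import numFieldNormedType.Exports.

Local Open Scope classical_set_scope.
Local Open Scope ring_scope.

(** * Functions on the 2-sphere that are periodic on great circles *)

(** Two reflected points of the equator are joined by four steps of spherical length [th], where [c]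
    and [s] are the cosine and sine of [th]. The bound [d0] is found before [F] is given, so one
    [d0] serves all rotated copies of [F]. *)
Lemma circle_zigzag (R : realType) (c s e : R) :
    c ^+ 2 + s ^+ 2 = 1 -> 0 < s -> 0 < e ->
  exists2 d0 : R, 0 < d0 & forall F : R -> R -> R -> R,
    (forall x1 x2 x3 y1 y2 y3,
      x1 ^+ 2 + x2 ^+ 2 + x3 ^+ 2 = 1 -> y1 ^+ 2 + y2 ^+ 2 + y3 ^+ 2 = 1 ->
      x1 * y1 + x2 * y2 + x3 * y3 = c -> `|x3| < e -> `|y3| < e ->
      F x1 x2 x3 = F y1 y2 y3) ->
    forall d, `|d| < d0 -> F (cos d) (- sin d) 0 = F (cos d) (sin d) 0.
Proof.
move=> cs s0 e0.
(* The chain is (cos d, - sin d, 0), (P, Y, Q), (X, 0, Z), (P, - Y, Q),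
   (cos d, sin d, 0), where [a] is the sine of the tilt, fixed while d tends to 0. *)
have s1 : s <= 1 by nra.
pose a := Num.min (1/2) (e/2).
have a0 : 0 < a by rewrite /a lt_min; apply/andP; split; lra.
have a1 : a <= 1/2 by rewrite /a ge_min lexx.
have ae : a <= e/2 by rewrite /a ge_min lexx orbT.
pose g := Num.sqrt (1 - a ^+ 2).
have ga : g ^+ 2 = 1 - a ^+ 2 by rewrite sqr_sqrtr//; nra.
pose Q := s * a.
have Q0 : 0 < Q by rewrite mulr_gt0.
have Qe : Q < e by rewrite /Q; nra.
pose P (d : R) := c * cos d + s * g * sin d.
pose Y d := - c * sin d + s * g * cos d.
pose N d := P d ^+ 2 + Q ^+ 2.
pose D d := Num.sqrt (N d - c ^+ 2).
(* [(X, Z)] is an intersection of the unit circle with the line [P X + Q Z = c]. Of the two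
   intersections, this sign of [D] picks the one tending to [(1, 0)] with [d] tending to 0, so that
   [Z] becomes small. *)
pose Z d := (c * Q - P d * D d) / N d.
pose X d := (c * P d + Q * D d) / N d.
have cP : P d @[d --> 0] --> c.
  suff : P d @[d --> 0] --> c * cos 0 + s * g * sin 0.
    by rewrite cos0 sin0 !mulr0 addr0 mulr1.
  apply: cvgD; apply: cvgMr; [exact: continuous_cos|exact: continuous_sin].
have cN : N d @[d --> 0] --> c ^+ 2 + Q ^+ 2.
  apply: cvgD; last exact: cvg_cst.
  by rewrite expr2; under eq_fun do rewrite expr2; apply: cvgM.
have cND : N d - c ^+ 2 @[d --> 0] --> Q ^+ 2.
  rewrite (_ : Q ^+ 2 = (c ^+ 2 + Q ^+ 2) - c ^+ 2); last by ring.
  by apply: cvgB => //; exact: cvg_cst.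
have cD : D d @[d --> 0] --> Q.
  suff : D d @[d --> 0] --> Num.sqrt (Q ^+ 2) by rewrite sqrtr_sqr gtr0_norm.
  by apply: (cvg_comp _ _ cND); exact: sqrt_continuous.
have cZ : Z d @[d --> 0] --> (0:R).
  suff : Z d @[d --> 0] --> (c * Q - c * Q) / (c ^+ 2 + Q ^+ 2).
    by rewrite subrr mul0r.
  apply: cvgM; first by apply: cvgB; [exact: cvg_cst|exact: cvgM].
  by apply: cvgV => //; apply: lt0r_neq0; nra.
have Q2 : 0 < Q ^+ 2 by rewrite exprn_gt0.
have : \forall d \near (0:R), `|Z d| < e /\ 0 < N d - c ^+ 2.
  near=> d; split; near: d.
    by move/cvgr0Pnorm_lt : cZ; apply.
  by move/cvgrPdist_lt : cND => /(_ _ Q2); apply: filterS => d;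
    rewrite ltr_norml => /andP[_]; lra.
move=> /nbhs_ballP[d0 /= d00 H]; exists d0 => // F VF d dd0.
have [{}H Nc] : `|Z d| < e /\ 0 < N d - c ^+ 2.
  by apply: H; rewrite /ball/= sub0r normrN.
have N0 : 0 < N d by have := sqr_ge0 c; lra.
have DE : D d ^+ 2 = N d - c ^+ 2 by rewrite sqr_sqrtr// ltW.
have cd := cos2Dsin2 d.
clearbody g a.
have YE : P d ^+ 2 + Y d ^+ 2 + Q ^+ 2 = 1.
  rewrite /P /Y /Q.
  transitivity ((c ^+ 2 + s ^+ 2 * g ^+ 2) * (cos d ^+ 2 + sin d ^+ 2) +
    s ^+ 2 * a ^+ 2); first by ring.
  by rewrite cd ga -[RHS]cs; ring.
have xy : cos d * P d + (- sin d) * Y d = c.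
  by rewrite /P /Y; transitivity (c * (cos d ^+ 2 + sin d ^+ 2));
    [ring|rewrite cd mulr1].
have XZ : X d ^+ 2 + Z d ^+ 2 = 1.
  rewrite /X /Z; transitivity ((c ^+ 2 + D d ^+ 2) * (P d ^+ 2 + Q ^+ 2) / N d ^+ 2).
    by field; exact: lt0r_neq0.
  by rewrite DE /N; field; exact: lt0r_neq0.
have XP : X d * P d + Z d * Q = c.
  rewrite /X /Z; transitivity (c * (P d ^+ 2 + Q ^+ 2) / N d).
    by field; exact: lt0r_neq0.
  by rewrite /N; field; exact: lt0r_neq0.
have Qe' : `|Q| < e by rewrite gtr0_norm.
have e0' : `|0:R| < e by rewrite normr0.
transitivity (F (P d) (Y d) Q).
  by apply: VF => //; [rewrite sqrrN -[RHS]cd; ring | rewrite -[RHS]xy; ring].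
transitivity (F (X d) 0 (Z d)).
  by apply: VF => //; [rewrite -[RHS]XZ; ring | rewrite -[RHS]XP; ring].
transitivity (F (P d) (- Y d) Q).
  by apply: VF => //; [rewrite -[RHS]XZ; ring |rewrite -[RHS]YE;
    ring | rewrite -[RHS]XP; ring].
by apply: VF => //; [rewrite -[RHS]YE; ring | rewrite -[RHS]cd;
  ring | rewrite -[RHS]xy; ring].
Unshelve. all: by end_near.
Qed.

(** Rotating [F] about the third axis preserves the hypothesis, so the zigzag applies around every
    point of the equator. The arc from 0 to [t] is then cut into [k] equal pieces of half-length
    below [d0]. *)
Lemma equator_constant (R : realType) (c s e : R) (F : R -> R -> R -> R) :
    c ^+ 2 + s ^+ 2 = 1 -> 0 < s -> 0 < e ->
    (forall x1 x2 x3 y1 y2 y3,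
      x1 ^+ 2 + x2 ^+ 2 + x3 ^+ 2 = 1 -> y1 ^+ 2 + y2 ^+ 2 + y3 ^+ 2 = 1 ->
      x1 * y1 + x2 * y2 + x3 * y3 = c -> `|x3| < e -> `|y3| < e ->
      F x1 x2 x3 = F y1 y2 y3) ->
  forall t, F (cos t) (sin t) 0 = F 1 0 0.
Proof.
move=> cs s0 e0 VF t.
have [d0 d00 H] := circle_zigzag cs s0 e0.
have step u d : `|d| < d0 ->
    F (cos (u - d)) (sin (u - d)) 0 = F (cos (u + d)) (sin (u + d)) 0.
  move=> dd0.
  have := H (fun a b z => F (a * cos u - b * sin u) (a * sin u + b * cos u) z) _ d dd0.
  rewrite cosB cosD sinB sinD => Hu.
  transitivity (F (cos d * cos u - - sin d * sin u) (cos d * sin u +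
    - sin d * cos u) 0).
    by congr F; ring.
  rewrite Hu; first by congr F; ring.
  move=> x1 x2 x3 y1 y2 y3 x1E y1E xyE x3e y3e; have cu := cos2Dsin2 u.
  apply: VF => //.
  - rewrite -[RHS]x1E; transitivity ((x1 ^+ 2 + x2 ^+ 2) * (cos u ^+ 2 +
    sin u ^+ 2) + x3 ^+ 2); first by ring.
    by rewrite cu mulr1.
  - rewrite -[RHS]y1E; transitivity ((y1 ^+ 2 + y2 ^+ 2) * (cos u ^+ 2 +
    sin u ^+ 2) + y3 ^+ 2); first by ring.
    by rewrite cu mulr1.
  - rewrite -[RHS]xyE; transitivity ((x1 * y1 + x2 * y2) * (cos u ^+ 2 +
    sin u ^+ 2) + x3 * y3); first by ring.
    by rewrite cu mulr1.
pose k := (Num.truncn (`|t| / d0)).+1.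
have kt : `|t| / d0 < k%:R by exact: truncnS_gt.
pose d := t / k%:R.
have k0 : 0 < k%:R :> R by rewrite ltr0n.
have dd0 : `|d / 2| < d0.
  have tk : `|t| < d0 * k%:R by rewrite -ltr_pdivrMl// mulrC.
  rewrite /d -mulrA -invfM normrM [X in _ * X]ger0_norm; last first.
    by rewrite invr_ge0 mulr_ge0// ltW.
  rewrite ltr_pdivrMr ?mulr_gt0//; have := normr_ge0 t; nra.
have it j : F (cos (j%:R * d)) (sin (j%:R * d)) 0 = F 1 0 0.
  elim: j => [|j <-]; first by rewrite mul0r cos0 sin0.
  have := step (j%:R * d + d/2) _ dd0.
  have -> : j%:R * d + d / 2 - d / 2 = j%:R * d by ring.
  have -> : j%:R * d + d / 2 + d / 2 = j.+1%:R * d by rewrite -natr1; field.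
  by move=> ->.
by rewrite -(it k) /d mulrCA divff ?mulr1// lt0r_neq0.
Qed.

(** * Algebraic certificates, polar coordinates and orthonormal frames *)

(** Once the cofactors [k] and [k'] are supplied, a consequence of two equations becomes a single
    identity for [ring] or [field]. *)
Lemma eq_of_lincomb2 (R : comPzRingType) (k l r k' l' r' a b : R) :
  l = r -> l' = r' -> a - b = k * (l - r) + k' * (l' - r') -> a = b.
Proof. by move=> -> -> /eqP; rewrite !subrr !mulr0 addr0 subr_eq0 => /eqP. Qed.

Lemma eq_of_lincomb3 (R : comPzRingType) (k l r k' l' r' k2 l2 r2 a b : R) :
  l = r -> l' = r' -> l2 = r2 ->
  a - b = k * (l - r) + k' * (l' - r') + k2 * (l2 - r2) -> a = b.
Proof. by move=> -> -> -> /eqP; rewrite !subrr !mulr0 !addr0 subr_eq0 => /eqP. Qed.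

(** The angle is kept in a compact interval, on which a continuous function of the angle attains its
    maximum. *)
Lemma unit_cos_sin (R : realType) (a b : R) : a ^+ 2 + b ^+ 2 = 1 ->
  exists t, [/\ - pi <= t <= pi, a = cos t & b = sin t].
Proof.
move=> ab; have a1 : -1 <= a <= 1 by nra.
have bE : Num.sqrt (1 - a ^+ 2) = `|b|.
  by rewrite (_ : 1 - a ^+ 2 = b ^+ 2) ?sqrtr_sqr// -ab; ring.
have := acos_ge0 a1; have := acos_lepi a1 => acospi acos0.
have [b0|b0] := leP 0 b.
  exists (acos a); rewrite acosK ?in_itv// sin_acos// bE ger0_norm//.
  by split => //; lra.
exists (- acos a); rewrite cosN sinN acosK ?in_itv// sin_acos// bE.
by rewrite ltr0_norm// opprK; split => //; lra.
Qed.

Lemma polar_coordinates (R : realType) (a b : R) :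
  0 < a ^+ 2 + b ^+ 2 -> exists r t, [/\ 0 < r, - pi <= t <= pi,
    a = r * cos t & b = r * sin t].
Proof.
move=> ab; pose r := Num.sqrt (a ^+ 2 + b ^+ 2).
have r0 : 0 < r by rewrite sqrtr_gt0.
have r2 : r ^+ 2 = a ^+ 2 + b ^+ 2 by rewrite sqr_sqrtr// ltW.
have [|t [tpi ta tb]] := @unit_cos_sin R (a / r) (b / r).
  by rewrite !expr_div_n -mulrDl -r2 divff// expf_neq0// lt0r_neq0.
exists r, t; split => //.
- by rewrite -ta mulrC divfK// lt0r_neq0.
- by rewrite -tb mulrC divfK// lt0r_neq0.
Qed.

Section orthogonal_frame.
Variables (R : rcfType) (q1 q2 q3 : R).
Hypothesis q30 : 0 < q3.

Let h := Num.sqrt (q1 ^+ 2 + q3 ^+ 2).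
Let N := Num.sqrt (q1 ^+ 2 + q2 ^+ 2 + q3 ^+ 2).

Lemma frame_lengths :
  [/\ 0 < h, 0 < N, h ^+ 2 = q1 ^+ 2 + q3 ^+ 2 & N ^+ 2 = h ^+ 2 + q2 ^+ 2].
Proof.
have q32 : 0 < q3 ^+ 2 by rewrite exprn_gt0.
have h0 : 0 < q1 ^+ 2 + q3 ^+ 2 by have := sqr_ge0 q1; lra.
have N0 : 0 < q1 ^+ 2 + q2 ^+ 2 + q3 ^+ 2 by have := sqr_ge0 q2; lra.
by split; rewrite ?sqrtr_gt0 ?sqr_sqrtr ?(ltW h0) ?(ltW N0)//; ring.
Qed.

Let frame_nonzero : (h != 0) && (N != 0).
Proof. by have [/lt0r_neq0-> /lt0r_neq0->] := frame_lengths. Qed.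

(** The frame consists of [u = (q3, 0, - q1) / h], orthogonal to [q] and to the second axis, of
    [p = q / N], and of [w], the cross product of [p] and [u]. Positivity of [q3] keeps [h] away
    from 0. *)
Lemma frame_orthonormal :
  [/\ (q3 / h) ^+ 2 + 0 ^+ 2 + (- q1 / h) ^+ 2 = 1,
      (- (q1 * q2) / (h * N)) ^+ 2 + (h / N) ^+ 2 + (- (q2 * q3) / (h * N)) ^+ 2 = 1,
      (q1 / N) ^+ 2 + (q2 / N) ^+ 2 + (q3 / N) ^+ 2 = 1,
      q3 / h * (- (q1 * q2) / (h * N)) + 0 * (h / N) +
        - q1 / h * (- (q2 * q3) / (h * N)) = 0 &
      q3 / h * (q1 / N) + 0 * (q2 / N) + - q1 / h * (q3 / N) = 0 /\
      - (q1 * q2) / (h * N) * (q1 / N) + h / N * (q2 / N) +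
        - (q2 * q3) / (h * N) * (q3 / N) = 0].
Proof.
have [_ _ h2 N2] := frame_lengths; have hN := frame_nonzero.
move: h N h2 N2 hN => k M h2 N2 kM; have /andP[k0 M0] := kM.
split.
- by apply: (@eq_of_lincomb2 _ (- (1 / k ^+ 2)) _ _ 0 _ _ _ _ h2 N2); field;
  rewrite ?k0 ?M0.
- by apply: (@eq_of_lincomb2 _ (- (q2 ^+ 2 / (k * M) ^+ 2)) _ _ (- (1 / M ^+ 2)) _
  _ _ _ h2 N2); field; rewrite ?k0 ?M0.
- by apply: (@eq_of_lincomb2 _ (- (1 / M ^+ 2)) _ _ (- (1 / M ^+ 2)) _ _ _ _ h2
  N2); field; rewrite ?k0 ?M0.
- by field; rewrite ?k0 ?M0.
split; first by field; rewrite ?k0 ?M0.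
by apply: (@eq_of_lincomb2 _ (q2 / (k * M ^+ 2)) _ _ 0 _ _ _ _ h2 N2); field;
  rewrite ?k0 ?M0.
Qed.

(** [a] and [b] are the scalar products of [x] with [u] and [w]; the second one simplifies to
    [x2 * N / h] because [x] is orthogonal to [q]. *)
Lemma frame_decomposition (x1 x2 x3 : R) :
    q1 * x1 + q2 * x2 + q3 * x3 = 0 ->
    let a := (x1 * q3 - x3 * q1) / h in let b := x2 * N / h in
  [/\ x1 = a * (q3 / h) + b * (- (q1 * q2) / (h * N)),
      x2 = a * 0 + b * (h / N) &
      x3 = a * (- q1 / h) + b * (- (q2 * q3) / (h * N))].
Proof.
have [_ _ h2 N2] := frame_lengths; have hN := frame_nonzero.
move: h N h2 N2 hN => k M h2 N2 kM qx a b; have /andP[k0 M0] := kM; rewrite /a /b;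
  split.
- by apply: (@eq_of_lincomb2 _ (x1 / k ^+ 2) _ _ (q1 / k ^+ 2) _ _ _ _ h2 qx);
  field; rewrite ?k0 ?M0.
- by field; rewrite ?k0 ?M0.
- by apply: (@eq_of_lincomb2 _ (x3 / k ^+ 2) _ _ (q3 / k ^+ 2) _ _ _ _ h2 qx);
  field; rewrite ?k0 ?M0.
Qed.

End orthogonal_frame.

(* [q x z] runs over the plane orthogonal to [q], and
   [cos th |q| u + sin th (q x u)] is [|q|] times the rotation of [u] by [th]
   in that plane: the great circle orthogonal to [q] has period [th]. *)
Definition circle_period (R : realType) (F : R -> R -> R -> R) (th q1 q2 q3 : R) :=
  forall z1 z2 z3,
    let u1 := q2 * z3 - q3 * z2 in
    let u2 := q3 * z1 - q1 * z3 in
    let u3 := q1 * z2 - q2 * z1 in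
    let N := Num.sqrt (q1 ^+ 2 + q2 ^+ 2 + q3 ^+ 2) in
    0 < u1 ^+ 2 + u2 ^+ 2 + u3 ^+ 2 ->
    F (cos th * N * u1 + sin th * (q2 * u3 - q3 * u2))
      (cos th * N * u2 + sin th * (q3 * u1 - q1 * u3))
      (cos th * N * u3 + sin th * (q1 * u2 - q2 * u1)) = F u1 u2 u3.

(** In the basis [u], [w] of the plane orthogonal to [q], the cross product with [q] is [N] times
    the quarter turn. A point with polar coordinates [r], [t] is thus sent to [N r] times the point
    of angle [t + th], and homogeneity removes the factors. *)
Lemma circle_period_frame (R : realType) (F : R -> R -> R -> R) (th q1 q2 q3 : R) :
    (forall k a b c, 0 < k -> F (k * a) (k * b) (k * c) = F a b c) ->
    0 < q3 ->
    let h := Num.sqrt (q1 ^+ 2 + q3 ^+ 2) in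
    let N := Num.sqrt (q1 ^+ 2 + q2 ^+ 2 + q3 ^+ 2) in
    let u1 := q3 / h in let u2 := 0 in let u3 := - q1 / h in
    let w1 := - (q1 * q2) / (h * N) in
    let w2 := h / N in
    let w3 := - (q2 * q3) / (h * N) in
    (forall t, F (cos (t + th) * u1 + sin (t + th) * w1)
                 (cos (t + th) * u2 + sin (t + th) * w2)
                 (cos (t + th) * u3 + sin (t + th) * w3) =
               F (cos t * u1 + sin t * w1)
                 (cos t * u2 + sin t * w2)
                 (cos t * u3 + sin t * w3)) ->
  circle_period F th q1 q2 q3.
Proof.
move=> Fhom q30 h N u1 u2 u3 w1 w2 w3 Fth z1 z2 z3 x1 x2 x3 N' x0.
rewrite {}/N' -/N.
have [h0 N0 h2 N2] := frame_lengths q1 q2 q30; rewrite -/h -/N in h0 N0 h2 N2.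
have hn := lt0r_neq0 h0; have Nn := lt0r_neq0 N0.
have qx : q1 * x1 + q2 * x2 + q3 * x3 = 0 by rewrite /x1 /x2 /x3; ring.
have := frame_decomposition q30 qx.
rewrite /= -/h -/N; set a := (x1 * _ - _) / h; set b := x2 * N / h => -[X1 X2 X3].
rewrite -/u1 -/u3 -/w1 -/w2 -/w3 in X1 X2 X3.
rewrite -[0]/u2 in X2.
clearbody x1 x2 x3 h N.
have C1 : q2 * x3 - q3 * x2 = N * (a * w1 - b * u1).
  rewrite /a /b /u1 /w1.
  by apply: (@eq_of_lincomb3 _ (q2 * x3 / h ^+ 2) _ _ (q2 * q3 / h ^+ 2) _ _
    (x2 * q3 / h ^+ 2) _ _ _ _ h2 qx N2); field; exact/andP.
have C2 : q3 * x1 - q1 * x3 = N * (a * w2 - b * u2).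
  by rewrite /a /b /u2 /w2; field; exact/andP.
have C3 : q1 * x2 - q2 * x1 = N * (a * w3 - b * u3).
  rewrite /a /b /u3 /w3.
  by apply: (@eq_of_lincomb3 _ (- (q2 * x1) / h ^+ 2) _ _ (- (q1 * q2) / h ^+ 2) _ _
    (- (x2 * q1) / h ^+ 2) _ _ _ _ h2 qx N2); field; exact/andP.
have ab0 : 0 < a ^+ 2 + b ^+ 2.
  rewrite lt_neqAle addr_ge0 ?sqr_ge0// andbT eq_sym.
  apply/negP; rewrite paddr_eq0 ?sqr_ge0// !sqrf_eq0 => /andP[/eqP az /eqP bz].
  by move: x0; rewrite X1 X2 X3 az bz !mul0r !addr0 !expr0n /= !addr0 ltxx.
have [r [t [r0 _ ar br]]] := polar_coordinates ab0.
rewrite C1 C2 C3.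
transitivity (F (N * r * (cos (t + th) * u1 + sin (t + th) * w1))
  (N * r * (cos (t + th) * u2 + sin (t + th) * w2))
  (N * r * (cos (t + th) * u3 + sin (t + th) * w3))).
  by rewrite cosD sinD X1 X2 X3 ar br; congr F; ring.
rewrite Fhom ?mulr_gt0// Fth -(Fhom r)// X1 X2 X3 ar br.
by congr F; ring.
Qed.

(** * Failure of a period as an open condition *)

(** The origin is excluded because a function invariant under positive scaling is continuous there
    only if it is constant. *)
Definition continuous_off0 (R : realType) (F : R -> R -> R -> R) :=
  forall a b c, 0 < a ^+ 2 + b ^+ 2 + c ^+ 2 ->
    {for (a, b, c), continuous (fun p : R * R * R => F p.1.1 p.1.2 p.2)}.

Lemma continuous_off0_comp (R : realType) (F : R -> R -> R -> R)
    (T : topologicalType) (t : T) (f g h : T -> R) :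
    continuous_off0 F -> 0 < f t ^+ 2 + g t ^+ 2 + h t ^+ 2 ->
    {for t, continuous f} -> {for t, continuous g} -> {for t, continuous h} ->
  {for t, continuous (fun x => F (f x) (g x) (h x))}.
Proof.
move=> cF n0 cf cg ch.
apply: (@continuous_comp _ _ _ (fun x => (f x, g x, h x))
  (fun p : R * R * R => F p.1.1 p.1.2 p.2)); last exact: cF.
exact: (cvg_pair (cvg_pair cf cg) ch).
Qed.

Local Notation "q `_0" := ((q : 'rV_3) ord0 (@Ordinal 3 0 isT)) (at level 2,
  format "q `_0").
Local Notation "q `_1" := ((q : 'rV_3) ord0 (@Ordinal 3 1 isT)) (at level 2,
  format "q `_1").
Local Notation "q `_2" := ((q : 'rV_3) ord0 (@Ordinal 3 2 isT)) (at level 2,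
  format "q `_2").

Section continuous_polynomial.
Variables (R : realType) (T : topologicalType) (t : T).
Implicit Types f g : T -> R.

Lemma continuous_add f g : {for t, continuous f} -> {for t, continuous g} ->
  {for t, continuous (fun x => f x + g x)}.
Proof. exact: continuousD. Qed.

Lemma continuous_opp f : {for t, continuous f} ->
  {for t, continuous (fun x => - f x)}.
Proof. exact: continuousN. Qed.

Lemma continuous_mul f g : {for t, continuous f} -> {for t, continuous g} ->
  {for t, continuous (fun x => f x * g x)}.
Proof. exact: continuousM. Qed.

Lemma continuous_sqr f :
  {for t, continuous f} -> {for t, continuous (fun x => f x ^+ 2)}.
Proof. by move=> cf; apply: continuousM. Qed.

Lemma continuous_const (a : R) : {for t, continuous (fun _ : T => a)}.
Proof. exact: cst_continuous. Qed.

End continuous_polynomial.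

Ltac solve_continuous :=
  lazymatch goal with
  | |- prop_for ?q (inPhantom (continuous ?f)) =>
    lazymatch f with
    | (fun _ => ?a) => exact: continuous_const
    | (fun x => GRing.add (@?a x) (@?b x)) =>
        apply: (@continuous_add _ _ q a b); solve_continuous
    | (fun x => GRing.mul (@?a x) (@?b x)) =>
        apply: (@continuous_mul _ _ q a b); solve_continuous
    | (fun x => GRing.opp (@?a x)) =>
        apply: (@continuous_opp _ _ q a); solve_continuous
    | (fun x => GRing.exp (@?a x) 2) =>
        apply: (@continuous_sqr _ _ q a); solve_continuous
    | (fun x => fun_of_matrix _ _ _) => exact: coord_continuous
    | (fun x => cos x) => exact: continuous_cos
    | (fun x => sin x) => exact: continuous_sin
    | _ => assumption
    end
  end.

(** A failure of the period is witnessed by some [z]. With [z] fixed, the point [u] (the cross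
    product of the normal and [z]) and its rotated image [v] depend continuously on the normal, so
    the two values of [F] stay different nearby. *)
Lemma near_not_circle_period (R : realType) (F : R -> R -> R -> R) (th : R) (q :
  'rV[R]_3) :
    continuous_off0 F -> 0 < q`_0 ^+ 2 + q`_1 ^+ 2 + q`_2 ^+ 2 ->
    ~ circle_period F th q`_0 q`_1 q`_2 ->
  \forall r \near (q : 'rV[R]_3), ~ circle_period F th r`_0 r`_1 r`_2.
Proof.
move=> cF q0 /existsNP[z1] /existsNP[z2] /existsNP[z3] /=.
move=> /not_implyP[x0 /eqP Fx].
pose u1 (r : 'rV[R]_3) := r`_1 * z3 - r`_2 * z2.
pose u2 (r : 'rV[R]_3) := r`_2 * z1 - r`_0 * z3.
pose u3 (r : 'rV[R]_3) := r`_0 * z2 - r`_1 * z1.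
pose N (r : 'rV[R]_3) := Num.sqrt (r`_0 ^+ 2 + r`_1 ^+ 2 + r`_2 ^+ 2).
pose v1 (r : 'rV[R]_3) := cos th * N r * u1 r + sin th * (r`_1 * u3 r - r`_2 * u2 r).
pose v2 (r : 'rV[R]_3) := cos th * N r * u2 r + sin th * (r`_2 * u1 r - r`_0 * u3 r).
pose v3 (r : 'rV[R]_3) := cos th * N r * u3 r + sin th * (r`_0 * u2 r - r`_1 * u1 r).
have cN : {for q, continuous N}.
  apply: (@continuous_comp _ _ _ (fun r : 'rV[R]_3 =>
    r`_0 ^+ 2 + r`_1 ^+ 2 + r`_2 ^+ 2)); last exact: sqrt_continuous.
  by solve_continuous.
have cu1 : {for q, continuous u1} by rewrite /u1; solve_continuous.
have cu2 : {for q, continuous u2} by rewrite /u2; solve_continuous.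
have cu3 : {for q, continuous u3} by rewrite /u3; solve_continuous.
have cv1 : {for q, continuous v1} by rewrite /v1; solve_continuous.
have cv2 : {for q, continuous v2} by rewrite /v2; solve_continuous.
have cv3 : {for q, continuous v3} by rewrite /v3; solve_continuous.
(* [v] is [|q|] times a rotation of [u], so it is nonzero and [F] is continuous at it. *)
have v0 : 0 < v1 q ^+ 2 + v2 q ^+ 2 + v3 q ^+ 2.
  have N2 : N q ^+ 2 = q`_0 ^+ 2 + q`_1 ^+ 2 + q`_2 ^+ 2 by rewrite sqr_sqrtr// ltW.
  suff -> : v1 q ^+ 2 + v2 q ^+ 2 + v3 q ^+ 2 =
      (q`_0 ^+ 2 + q`_1 ^+ 2 + q`_2 ^+ 2) * (u1 q ^+ 2 + u2 q ^+ 2 + u3 q ^+ 2).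
    exact: mulr_gt0.
  apply: (@eq_of_lincomb2 _ (cos th ^+ 2 * (u1 q ^+ 2 + u2 q ^+ 2 + u3 q ^+ 2)) _ _
    ((q`_0 ^+ 2 + q`_1 ^+ 2 + q`_2 ^+ 2) * (u1 q ^+ 2 + u2 q ^+ 2 +
      u3 q ^+ 2)) _ _ _ _ N2
    (cos2Dsin2 th)).
  by rewrite /v1 /v2 /v3 /u1 /u2 /u3; ring.
have cE : {for q, continuous (fun r =>
  F (v1 r) (v2 r) (v3 r) - F (u1 r) (u2 r) (u3 r))}.
  by apply: continuousB; exact: continuous_off0_comp.
have u_near : \forall r \near q, 0 < u1 r ^+ 2 + u2 r ^+ 2 + u3 r ^+ 2.
  have : {for q, continuous (fun r =>
    u1 r ^+ 2 + u2 r ^+ 2 + u3 r ^+ 2)} by solve_continuous.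
  by move/cvgr_gt => /(_ 0 x0).
move/cvgr_neq0 : cE; rewrite subr_eq0 => /(_ Fx) E_near.
near=> r; move=> /(_ z1 z2 z3) /= Fr.
have : F (v1 r) (v2 r) (v3 r) - F (u1 r) (u2 r) (u3 r) != 0 by near: r.
rewrite subr_eq0 => /eqP; apply; apply: Fr.
by near: r.
Unshelve. all: by end_near.
Qed.

Lemma sqr_lt_norm (R : realDomainType) (a b : R) : 0 < b -> a ^+ 2 < b ^+ 2 -> `|a| < b.
Proof. by move=> b0; rewrite -[a ^+ 2]real_normK ?num_real// ltr_pXn2r// nnegrE
  ltW. Qed.

(** * Equal values near a great circle *)

(** The vector [q], [k] times the cross product of [x] and [y], is normal to the great circle
    through [x] and [y] and oriented so that the rotation by [th] takes [x] to [y]. *)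
Lemma circle_period_same_value (R : realType) (F : R -> R -> R -> R)
    (th x1 x2 x3 y1 y2 y3 k : R) :
    (forall k a b c, 0 < k -> F (k * a) (k * b) (k * c) = F a b c) ->
    0 < sin th -> 0 < k ->
    x1 ^+ 2 + x2 ^+ 2 + x3 ^+ 2 = 1 -> y1 ^+ 2 + y2 ^+ 2 + y3 ^+ 2 = 1 ->
    x1 * y1 + x2 * y2 + x3 * y3 = cos th ->
    circle_period F th (k * (x2 * y3 - x3 * y2)) (k * (x3 * y1 - x1 * y3))
      (k * (x1 * y2 - x2 * y1)) ->
  F x1 x2 x3 = F y1 y2 y3.
Proof.
move=> Fhom s0 k0 xx yy xy.
set q1 := k * _; set q2 := k * (x3 * _ - _); set q3 := k * (x1 * y2 - _).
pose K := k * sin th.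
have K0 : 0 < K by rewrite mulr_gt0.
have K2n : K ^+ 2 != 0 by rewrite expf_neq0// lt0r_neq0.
have qq : q1 ^+ 2 + q2 ^+ 2 + q3 ^+ 2 = K ^+ 2.
  have -> : K ^+ 2 = k ^+ 2 * (1 - cos th ^+ 2) by rewrite /K exprMn sin2cos2.
  rewrite -xy /q1 /q2 /q3.
  apply: (@eq_of_lincomb2 _ (k ^+ 2 * (y1 ^+ 2 + y2 ^+ 2 +
    y3 ^+ 2)) _ _ (k ^+ 2) _ _ _ _ xx yy).
  by ring.
have qx : q1 * x1 + q2 * x2 + q3 * x3 = 0 by rewrite /q1 /q2 /q3; ring.
(* This [z] is the cross product of [x] and [q] divided by [|q|^2]; since [x] is orthogonal to [q],
   the cross product of [q] and [z] is [x]. *)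
move=> /(_ ((x2 * q3 - x3 * q2) / K ^+ 2) ((x3 * q1 - x1 * q3) / K ^+ 2)
  ((x1 * q2 - x2 * q1) / K ^+ 2)) /=.
rewrite qq sqrtr_sqr gtr0_norm//.
have -> : q2 * ((x1 * q2 - x2 * q1) / K ^+ 2) - q3 * ((x3 * q1 - x1 * q3) / K ^+ 2)
  = x1.
  apply: (@eq_of_lincomb2 _ (x1 / K ^+ 2) _ _ (- q1 / K ^+ 2) _ _ _ _ qq qx).
  by field; move: K2n; rewrite sqrf_eq0.
have -> : q3 * ((x2 * q3 - x3 * q2) / K ^+ 2) - q1 * ((x1 * q2 - x2 * q1) / K ^+ 2)
  = x2.
  apply: (@eq_of_lincomb2 _ (x2 / K ^+ 2) _ _ (- q2 / K ^+ 2) _ _ _ _ qq qx).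
  by field; move: K2n; rewrite sqrf_eq0.
have -> : q1 * ((x3 * q1 - x1 * q3) / K ^+ 2) - q2 * ((x2 * q3 - x3 * q2) / K ^+ 2)
  = x3.
  apply: (@eq_of_lincomb2 _ (x3 / K ^+ 2) _ _ (- q3 / K ^+ 2) _ _ _ _ qq qx).
  by field; move: K2n; rewrite sqrf_eq0.
move=> Fq; rewrite -Fq ?xx ?ltr01// -[RHS](Fhom K)//; congr F.
- apply: (@eq_of_lincomb2 _ (K * y1) _ _ (- K * x1) _ _ _ _ xx xy).
  by rewrite /K /q1 /q2 /q3; ring.
- apply: (@eq_of_lincomb2 _ (K * y2) _ _ (- K * x2) _ _ _ _ xx xy).
  by rewrite /K /q1 /q2 /q3; ring.
- apply: (@eq_of_lincomb2 _ (K * y3) _ _ (- K * x3) _ _ _ _ xx xy).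
  by rewrite /K /q1 /q2 /q3; ring.
Qed.

(** If [x] and [y] at distance [th] are both close to the plane orthogonal to [p], their normalised
    cross product is close to [p] or [- p]. Rescaled to length [K], it falls in the box of normals
    known to have period [th]. *)
Lemma same_value_near_circle (R : realType) (F : R -> R -> R -> R)
    (th p1 p2 p3 K r : R) :
    (forall k a b c, 0 < k -> F (k * a) (k * b) (k * c) = F a b c) ->
    0 < sin th -> 0 < K -> 0 < r -> p1 ^+ 2 + p2 ^+ 2 + p3 ^+ 2 = 1 ->
    (forall q1 q2 q3, `|K * p1 - q1| < r -> `|K * p2 - q2| < r ->
      `|K * p3 - q3| < r -> circle_period F th q1 q2 q3) ->
  exists2 e, 0 < e & forall x1 x2 x3 y1 y2 y3,
      x1 ^+ 2 + x2 ^+ 2 + x3 ^+ 2 = 1 -> y1 ^+ 2 + y2 ^+ 2 + y3 ^+ 2 = 1 ->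
      x1 * y1 + x2 * y2 + x3 * y3 = cos th ->
      `|x1 * p1 + x2 * p2 + x3 * p3| < e -> `|y1 * p1 + y2 * p2 + y3 * p3| < e ->
    F x1 x2 x3 = F y1 y2 y3.
Proof.
move=> Fhom s0 K0 r0 pp Fper.
pose s := sin th; pose c := cos th.
have cs : c ^+ 2 + s ^+ 2 = 1 by exact: cos2Dsin2.
(* This makes the final bound [8 K^2 e^2 / s^2] on the squared distance equal to [r^2 / 2]. *)
pose e := r * s / (4 * K).
have e0 : 0 < e by rewrite divr_gt0 ?mulr_gt0.
exists e => //.
have main x1 x2 x3 y1 y2 y3 :
    x1 ^+ 2 + x2 ^+ 2 + x3 ^+ 2 = 1 -> y1 ^+ 2 + y2 ^+ 2 + y3 ^+ 2 = 1 ->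
    x1 * y1 + x2 * y2 + x3 * y3 = cos th ->
    `|x1 * p1 + x2 * p2 + x3 * p3| < e -> `|y1 * p1 + y2 * p2 + y3 * p3| < e ->
    0 <= (x2 * y3 - x3 * y2) * p1 + (x3 * y1 - x1 * y3) * p2 +
      (x1 * y2 - x2 * y1) * p3 ->
    F x1 x2 x3 = F y1 y2 y3.
  move=> xx yy xy; rewrite -/c in xy.
  set a := x1 * p1 + _ + _; set b := y1 * p1 + _ + _.
  set n1 := x2 * y3 - _; set n2 := x3 * y1 - _; set n3 := x1 * y2 - _.
  set d := n1 * p1 + _ + _.
  move=> ae be d0.
  have nn : n1 ^+ 2 + n2 ^+ 2 + n3 ^+ 2 = s ^+ 2.
    rewrite (_ : s ^+ 2 = 1 - c ^+ 2); last by rewrite -cs; ring.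
    rewrite -xy /n1 /n2 /n3.
    by apply: (@eq_of_lincomb2 _ (y1 ^+ 2 + y2 ^+ 2 +
      y3 ^+ 2) _ _ 1 _ _ _ _ xx yy); ring.
  (* d is the determinant of (p, x, y), so d^2 is their Gram determinant. *)
  have dd : d ^+ 2 = s ^+ 2 - a ^+ 2 - b ^+ 2 + 2 * c * a * b.
    transitivity ((p1 ^+ 2 + p2 ^+ 2 + p3 ^+ 2) * (n1 ^+ 2 + n2 ^+ 2 + n3 ^+ 2)
        - a ^+ 2 * (y1 ^+ 2 + y2 ^+ 2 + y3 ^+ 2)
        + 2 * (x1 * y1 + x2 * y2 + x3 * y3) * a * b
        - b ^+ 2 * (x1 ^+ 2 + x2 ^+ 2 + x3 ^+ 2)).
      by rewrite /d /n1 /n2 /n3 /a /b; ring.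
    by rewrite pp nn yy xy xx; ring.
  have a2 : a ^+ 2 < e ^+ 2 by move: ae; rewrite ltr_norml => /andP[]; nra.
  have b2 : b ^+ 2 < e ^+ 2 by move: be; rewrite ltr_norml => /andP[]; nra.
  have c1 : -1 <= c <= 1 by nra.
  have b2c : 0 <= (1 - c ^+ 2) * b ^+ 2 by rewrite mulr_ge0 ?sqr_ge0//; nra.
  have ab : a ^+ 2 + b ^+ 2 - 2 * c * a * b <= 4 * e ^+ 2.
    by have := sqr_ge0 (a + c * b); nra.
  have ab0 : 0 <= a ^+ 2 + b ^+ 2 - 2 * c * a * b.
    by have := sqr_ge0 (a - c * b); nra.
  have ds : d <= s by rewrite -(@ler_pXn2r _ 2) ?nnegrE ?(ltW s0)// dd; lra.
  have sn : s != 0 by exact: lt0r_neq0.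
  (* As [0 <= d <= s], the left side is at most [s^2 - d^2], which is the quadratic form in [a] and
     [b] just bounded. *)
  have ds2 : s ^+ 2 - d * s <= 4 * e ^+ 2.
    apply: le_trans ab; have dsd : 0 <= d * (s - d) by rewrite mulr_ge0// subr_ge0.
    rewrite -subr_ge0; apply: le_trans dsd _.
    rewrite -(subr_ge0 (d * _)) (_ : _ - _ = 0)//.
    transitivity (d ^+ 2 - (s ^+ 2 - a ^+ 2 - b ^+ 2 + 2 * c * a * b)); first by ring.
    by rewrite dd subrr.
  have dist : (K * p1 - K / s * n1) ^+ 2 + (K * p2 - K / s * n2) ^+ 2 +
    (K * p3 - K / s * n3) ^+ 2 < r ^+ 2.
    have -> : (K * p1 - K / s * n1) ^+ 2 + (K * p2 - K / s * n2) ^+ 2 +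
        (K * p3 - K / s * n3) ^+ 2 = 2 * K ^+ 2 / s ^+ 2 * (s ^+ 2 - d * s).
      apply: (@eq_of_lincomb2 _ (K ^+ 2) _ _ (K ^+ 2 / s ^+ 2) _ _ _ _ pp nn).
      by rewrite /d; field.
    apply: (@le_lt_trans _ _ (2 * K ^+ 2 / s ^+ 2 * (4 * e ^+ 2))).
      by rewrite ler_wpM2l// divr_ge0// ?sqr_ge0// mulr_ge0// sqr_ge0.
    have -> : 2 * K ^+ 2 / s ^+ 2 * (4 * e ^+ 2) = r ^+ 2 / 2.
      by rewrite /e; field; rewrite sn lt0r_neq0.
    by have := exprn_gt0 2 r0; lra.
  apply: (@circle_period_same_value _ _ th _ _ _ _ _ _ (K / s)) => //.
    by rewrite divr_gt0.
  have term (u v w : R) : [/\ u ^+ 2 <= u ^+ 2 + v ^+ 2 + w ^+ 2,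
      v ^+ 2 <= u ^+ 2 + v ^+ 2 + w ^+ 2 & w ^+ 2 <= u ^+ 2 + v ^+ 2 + w ^+ 2].
    by have := sqr_ge0 u; have := sqr_ge0 v; have := sqr_ge0 w; split; lra.
  have [t1 t2 t3] := term (K * p1 - K / s * n1) (K * p2 - K / s * n2) (K * p3 - K /
    s * n3).
  by apply: Fper; apply: sqr_lt_norm => //; apply: le_lt_trans dist.
move=> x1 x2 x3 y1 y2 y3 xx yy xy xp yp.
have [n0|n0] := leP 0 ((x2 * y3 - x3 * y2) * p1 + (x3 * y1 - x1 * y3) * p2 +
  (x1 * y2 - x2 * y1) * p3).
  exact: main.
(* Exchanging [x] and [y] reverses the sign of the determinant. *)
apply/esym/main => //; first by rewrite -xy; ring.
by move/ltW: n0; rewrite -oppr_ge0; congr (_ <= _); ring.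
Qed.

(* The library declares the two parents of this structure on matrices, but not
   their join. *)
HB.instance Definition _ (R : realType) (m n : nat) :=
  Uniform_isComplete.Build 'M[R]_(m, n) cauchy_cvg.

Lemma baire_cover (R : realType) (U : completeNormedModType R) (A : set U)
    (P : nat -> set U) (x : U) :
    nbhs x A -> (forall y, A y -> exists m, P m y) ->
    (forall m y, A y -> ~ P m y -> \forall z \near y, ~ P m z) ->
  exists m y, A y /\ \forall z \near y, P m z.
Proof.
move=> xA covA clP; apply: contrapT => noint.
have [e /= e0 eA] : exists2 e : R, 0 < e & closed_ball x e `<=` A.
  by move/nbhs_closedballP : xA => [e eA]; exists e%:num.
pose B := closed_ball x e.
(* Adding the complement of [B] makes [G m] dense in the whole space when [P m] has no interior
   point in [A]. A point of the interior of [B] in all the [G m] would then lie in no [P m]. *)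
pose G m := ~` B `|` [set y | \forall z \near y, ~ P m z].
have GB : dense (\bigcap_m G m).
  apply: (@Baire R) => m; split.
    apply: openU; first exact/closed_openC/closed_ball_closed.
    by rewrite openE => y; rewrite /interior/= => /nbhs_interior.
  move=> O [y Oy] oO; apply: contrapT => OG; apply: noint; exists m, y.
  have OP z : O z -> A z /\ P m z.
    move=> Oz; have Bz : B z.
      by apply: contrapT => Bz; apply: OG; exists z; split => //; left.
    split; first exact: eA.
    apply: contrapT => Pz; apply: OG; exists z; split => //; right.
    exact/clP/Pz/eA.
  split; first by have [] := OP _ Oy.
  have : nbhs y O by exact: open_nbhs_nbhs.
  by apply: filterS => z /OP[].
have [||y [By Gy]] := GB (B°).
- by exists x; apply: nbhs_singleton; apply: nbhs_interior; apply/nbhs_closedballP;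
  exists (PosNum e0).
- exact: open_interior.
have {}By := interior_subset By.
have [m Pm] := covA _ (eA _ By).
by have [//|/nbhs_singleton] := Gy m Logic.I.
Qed.

(** [m.+3] ranges over the integers at least 3, so [0 < th < pi] and [sin th] is positive, as the
    zigzag requires. *)
Lemma periodic_great_circles_constant (R : realType) (F : R -> R -> R -> R) :
    continuous_off0 F ->
    (forall k a b c, 0 < k -> F (k * a) (k * b) (k * c) = F a b c) ->
    (forall u1 u2 u3 w1 w2 w3,
      u1 ^+ 2 + u2 ^+ 2 + u3 ^+ 2 = 1 -> w1 ^+ 2 + w2 ^+ 2 + w3 ^+ 2 = 1 ->
      u1 * w1 + u2 * w2 + u3 * w3 = 0 ->
      exists m : nat, let th := 2 * pi / m.+3%:R in
        forall t, F (cos (t + th) * u1 + sin (t + th) * w1)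
                    (cos (t + th) * u2 + sin (t + th) * w2)
                    (cos (t + th) * u3 + sin (t + th) * w3) =
                  F (cos t * u1 + sin t * w1)
                    (cos t * u2 + sin t * w2)
                    (cos t * u3 + sin t * w3)) ->
  forall t, F (cos t) (sin t) 0 = F 1 0 0.
Proof.
move=> cF Fhom Fper t0; apply: contrapT => /eqP Ft0.
pose th (m : nat) : R := 2 * pi / m.+3%:R.
have sth m : 0 < sin (th m).
  apply: sin_gt0_pi; rewrite /th; apply/andP; split.
    by rewrite divr_gt0 ?mulr_gt0// pi_gt0.
  rewrite ltr_pdivrMr// mulrC ltr_pM2l ?pi_gt0// ltr_nat.
  by [].
(* The two points are cross products of [q] with fixed vectors, hence lie in the plane orthogonal to
   [q]; for [q = e3] they are [(cos t0, sin t0, 0)] and [(1, 0, 0)]. Membership in [A] thus shows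
   that [F] is not constant on the circle of [q]. *)
pose A : set 'rV[R]_3 := [set q | 0 < q`_2 /\
  F (q`_1 * 0 - q`_2 * - cos t0) (q`_2 * sin t0 - q`_0 * 0)
    (q`_0 * - cos t0 - q`_1 * sin t0) !=
  F (q`_1 * 0 - q`_2 * - 1) (q`_2 * 0 - q`_0 * 0) (q`_0 * - 1 - q`_1 * 0)].
pose e3 : 'rV[R]_3 := \row_i [:: 0; 0; 1]`_i.
have e3A : nbhs e3 A.
  have c0 : {for e3, continuous (fun q : 'rV[R]_3 => q`_2)} by exact: coord_continuous.
  have e30 : e3`_0 = 0 by rewrite mxE.
  have e31 : e3`_1 = 0 by rewrite mxE.
  have e32 : e3`_2 = 1 by rewrite mxE.
  have cA (z1 z2 z3 : R) : 0 < z1 ^+ 2 + z2 ^+ 2 -> {for e3,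
    continuous (fun q : 'rV[R]_3 =>
      F (q`_1 * z3 - q`_2 * z2) (q`_2 * z1 - q`_0 * z3) (q`_0 * z2 - q`_1 * z1))}.
    move=> z0; apply: continuous_off0_comp => //; last 3 first.
    - by solve_continuous.
    - by solve_continuous.
    - by solve_continuous.
    by rewrite e30 e31 e32; apply: lt_le_trans z0 _; rewrite le_eqVlt; apply/orP;
      left; apply/eqP; ring.
  have c1 : {for e3, continuous (fun q : 'rV[R]_3 => F (q`_1 * 0 - q`_2 * - cos t0)
      (q`_2 * sin t0 - q`_0 * 0) (q`_0 * - cos t0 - q`_1 * sin t0))}.
    by apply: cA; rewrite sqrrN addrC cos2Dsin2.
  have c2 : {for e3, continuous (fun q : 'rV[R]_3 => F (q`_1 * 0 - q`_2 * - 1)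
      (q`_2 * 0 - q`_0 * 0) (q`_0 * - 1 - q`_1 * 0))}.
    by apply: cA; rewrite sqrrN expr0n expr1n add0r.
  apply: filterI; first by move/cvgr_gt : c0; apply; rewrite e32.
  have cB := continuous_add c1 (continuous_opp c2).
  have : \forall q \near e3, F (q`_1 * 0 - q`_2 * - cos t0) (q`_2 * sin t0 - q`_0 * 0)
    (q`_0 * - cos t0 - q`_1 * sin t0) - F (q`_1 * 0 - q`_2 * - 1) (q`_2 * 0 - q`_0 * 0)
    (q`_0 * - 1 - q`_1 * 0) != 0.
    move/cvgr_neq0 : cB; apply.
    rewrite e30 e31 e32 subr_eq0; apply: contra_neq Ft0 => E.
    transitivity (F (0 * 0 - 1 * - cos t0) (1 * sin t0 - 0 * 0) (0 * - cos t0 - 0 *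
      sin t0)).
      by congr F; ring.
    by rewrite E; congr F; ring.
  by apply: filterS => q; rewrite subr_eq0.
have [m [q [[q2 Fq] Pq]]] : exists m y, A y /\ \forall z \near (y : 'rV[R]_3),
  circle_period F (th m) z`_0 z`_1 z`_2.
  have := (@baire_cover R 'rV[R]_3 A (fun m =>
    [set z : 'rV[R]_3 | circle_period F (th m) z`_0 z`_1 z`_2]) e3). apply.
  - exact: e3A.
  - move=> y [y2 _].
    have [uu ww _ uw _] := frame_orthonormal (y`_0) (y`_1) y2.
    have [m Fm] := Fper _ _ _ _ _ _ uu ww uw.
    by exists m; apply: circle_period_frame.
  - move=> m y [y2 _] nP; apply: near_not_circle_period => //.
    have := sqr_ge0 (y`_0); have := sqr_ge0 (y`_1); have := exprn_gt0 2 y2; lra.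
move/nbhs_ballP : Pq => [r /= r0 Pq].
have [h0 N0 h2 N2] := frame_lengths (q`_0) (q`_1) q2.
have [uu ww pp uw [up wp]] := frame_orthonormal (q`_0) (q`_1) q2.
have dec := @frame_decomposition R (q`_0) (q`_1) (q`_2) q2.
set h := Num.sqrt (_ + _) in h0 h2 uu ww uw up wp dec.
set N := Num.sqrt _ in N0 N2 uu ww pp uw up wp dec.
set u1 := _ / h in uu uw up dec; set u3 := _ / h in uu uw up dec.
set w1 := _ / (h * N) in ww uw wp dec; set w2 := h / N in ww uw wp dec.
set w3 := _ / (h * N) in ww uw wp dec.
set p1 := _ / N in pp up wp; set p2 := _ / N in pp up wp; set p3 := _ / N in pp up wp.
have dot x1 x2 x3 y1 y2 y3 :
    (x1 * u1 + x2 * w1 + x3 * p1) * (y1 * u1 + y2 * w1 + y3 * p1) +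
    (x1 * 0 + x2 * w2 + x3 * p2) * (y1 * 0 + y2 * w2 + y3 * p2) +
    (x1 * u3 + x2 * w3 + x3 * p3) * (y1 * u3 + y2 * w3 + y3 * p3) =
    x1 * y1 + x2 * y2 + x3 * y3.
  transitivity (x1 * y1 * (u1 ^+ 2 + 0 ^+ 2 + u3 ^+ 2) + x2 * y2 * (w1 ^+ 2 +
    w2 ^+ 2 + w3 ^+ 2)
    + x3 * y3 * (p1 ^+ 2 + p2 ^+ 2 + p3 ^+ 2)
    + (x1 * y2 + x2 * y1) * (u1 * w1 + 0 * w2 + u3 * w3)
    + (x1 * y3 + x3 * y1) * (u1 * p1 + 0 * p2 + u3 * p3)
    + (x2 * y3 + x3 * y2) * (w1 * p1 + w2 * p2 + w3 * p3)).
    by ring.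
  by rewrite uu ww pp uw up wp; ring.
have dotp x1 x2 x3 : (x1 * u1 + x2 * w1 + x3 * p1) * p1 +
    (x1 * 0 + x2 * w2 + x3 * p2) * p2 + (x1 * u3 + x2 * w3 + x3 * p3) * p3 = x3.
  by have := dot x1 x2 x3 0 0 1; rewrite !(mul0r, mulr0, add0r, mul1r, mulr1).
(* Since [N p = q], taking [K = N] centres the box of normals at [q]. *)
have Np (a : R) : N * (a / N) = a by rewrite mulrC divfK// lt0r_neq0.
have [|e e0 Fe] := same_value_near_circle Fhom (sth m) N0 r0 pp.
  move=> z1 z2 z3; rewrite !Np => z1r z2r z3r.
  pose z : 'rV[R]_3 := \row_i [:: z1; z2; z3]`_i.
  have := Pq z; rewrite /= !mxE /=; apply.
  by split=> // i [[|[|[|//]]] j3]; rewrite !mxE (ord1 i) (bool_irrelevance j3 isT).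
(* [F'] is [F] in the frame [u], [w], [p]: the circle orthogonal to [q] becomes the equator. *)
pose F' a b c := F (a * u1 + b * w1 + c * p1) (a * 0 + b * w2 + c * p2) (a * u3 +
  b * w3 + c * p3).
have F'const : forall t, F' (cos t) (sin t) 0 = F' 1 0 0.
  apply: (equator_constant (cos2Dsin2 (th m)) (sth m) e0).
  move=> x1 x2 x3 y1 y2 y3 xx yy xy x3e y3e; apply: Fe; rewrite ?dotp//.
  - by rewrite !expr2 dot -!expr2.
  - by rewrite !expr2 dot -!expr2.
  - by rewrite dot.
have Fq_const x1 x2 x3 : 0 < x1 ^+ 2 + x2 ^+ 2 + x3 ^+ 2 ->
    q`_0 * x1 + q`_1 * x2 + q`_2 * x3 = 0 -> F x1 x2 x3 = F' 1 0 0.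
  move=> x0 qx; have [X1 X2 X3] := dec _ _ _ qx.
  set a := _ / h in X1 X2 X3; set b := _ / h in X1 X2 X3.
  have ab : 0 < a ^+ 2 + b ^+ 2.
    have := dot a b 0 a b 0.
    rewrite !mul0r !addr0 -X1 -X2 -X3 -!expr2 => <-; exact: x0.
  have [k [t [k0 _ ak bk]]] := polar_coordinates ab.
  rewrite -(F'const t) -[RHS](Fhom k)// X1 X2 X3 ak bk /u1 /u3 /w1 /w2 /w3.
  by congr F; ring.
have nz (z1 z2 : R) : 0 < z1 ^+ 2 + z2 ^+ 2 ->
    0 < (q`_1 * 0 - q`_2 * z2) ^+ 2 + (q`_2 * z1 - q`_0 * 0) ^+ 2 +
      (q`_0 * z2 - q`_1 * z1) ^+ 2.
  move=> z0; have : 0 < (q`_2) ^+ 2 * (z1 ^+ 2 +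
    z2 ^+ 2) by rewrite mulr_gt0// exprn_gt0.
  by have := sqr_ge0 (q`_0 * z2 - q`_1 * z1); nra.
move/eqP : Fq; apply; rewrite !Fq_const//; first [ring | apply: nz].
- by rewrite expr0n sqrrN expr1n add0r.
- by rewrite sqrrN addrC cos2Dsin2.
Qed.

(** * Periods of a continuous function *)

Section periods.
Variables (R : realType) (g : R -> R).

Definition is_period (p : R) := forall t, g (t + p) = g t.

Lemma is_periodB p q : is_period p -> is_period q -> is_period (p - q).
Proof. by move=> gp gq t; rewrite -gq addrA subrK gp. Qed.

Lemma is_periodN p : is_period p -> is_period (- p).
Proof. by move=> gp t; rewrite -gp subrK. Qed.

Lemma is_periodMn p k : is_period p -> is_period (k%:R * p).
Proof.
move=> gp; elim: k => [|k IH] t; first by rewrite mul0r addr0.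
by rewrite -natr1 mulrDl mul1r addrA gp IH.
Qed.

Lemma truncn_mod (p t : R) : 0 < p -> 0 <= t ->
  0 <= t - (Num.truncn (t / p))%:R * p < p.
Proof.
move=> p0 t0; have := truncn_itv (divr_ge0 t0 (ltW p0)).
rewrite ler_pdivlMr// ltr_pdivrMr// -natr1 mulrDl mul1r => /andP[].
by move=> ? ?; apply/andP; split; lra.
Qed.

(** Modulo a small period, every [t] is brought arbitrarily close to 0, where continuity compares
    the values. *)
Lemma small_periods_constant : continuous g ->
  (forall e, 0 < e -> exists2 p, 0 < p < e & is_period p) ->
  forall t, g t = g 0.
Proof.
move=> cg small t.
wlog t0 : t / 0 <= t => [H|].
  have [|tn] := leP 0 t; first exact: H.
  have [p /andP[p0 _] gp] := small 1 ltr01.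
  rewrite -(is_periodMn (Num.truncn (- t / p)).+1 gp); apply: H.
  have := @truncnS_gt _ (- t / p); rewrite ltr_pdivrMr//; lra.
apply/eqP; rewrite -subr_eq0 -normr_eq0; apply/eqP/le_anti.
rewrite normr_ge0 andbT; apply/ler_addgt0Pl => e e0; rewrite addr0.
have /cvgrPdist_lt/(_ _ e0)/nbhs_ballP[d /= d0 gd] := cg 0.
have [p /andP[p0 pd] gp] := small d d0.
have /andP[m0 mp] := truncn_mod p0 t0.
have <- : g (t - (Num.truncn (t / p))%:R * p) = g t.
  by rewrite -(is_periodMn (Num.truncn (t / p)) gp) subrK.
rewrite distrC; apply/ltW/gd.
by rewrite /ball/= sub0r normrN ger0_norm//; lra.
Qed.

Lemma sin_natpi k : sin (k%:R * pi : R) = 0.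
Proof.
elim: k => [|k IH]; first by rewrite mul0r sin0.
by rewrite -natr1 mulrDl mul1r sinDpi IH oppr0.
Qed.

(** Unless [g] is constant, there is a least positive period [p] and every period is a multiple of
    it. Writing [2 pi = k p], the cases [k = 1] and [k = 2] would make every period a multiple of
    [pi], where the sine vanishes. *)
Lemma primitive_period : continuous g -> is_period (2 * pi) ->
  (exists2 p, sin p != 0 & is_period p) ->
  exists m : nat, is_period (2 * pi / m.+3%:R).
Proof.
move=> cg g2pi [f sf gf].
pose P := [set p | 0 < p /\ is_period p].
have P2pi : P (2 * pi) by split; rewrite // mulr_gt0// pi_gt0.
have [/small_periods_constant const|] := pselect
    (forall e, 0 < e -> exists2 p, 0 < p < e & is_period p).
  by exists 0 => t; rewrite const// (const _ t).
move=> /existsNP[e /not_implyP[e0 noe]].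
have lbP : lbound P e.
  move=> p [p0 gp]; rewrite leNgt; apply/negP => pe.
  by apply: noe; exists p; rewrite ?p0.
have infP : has_inf P by split; [exists (2 * pi)|exists e].
have eP : e <= inf P by apply: lb_le_inf => //; exists (2 * pi).
(* Here [p < 2 inf P]. A smaller positive period [q] would make [p - q] a period as well, and both
   [q] and [p - q] are at least [inf P]. *)
have [p [p0 gp] pinf] := inf_adherent (lt_le_trans e0 eP) infP.
have pmin q : P q -> p <= q.
  move=> [q0 gq]; rewrite leNgt; apply/negP => qp.
  have : P (p - q) by split; [rewrite subr_gt0|exact: is_periodB].
  move=> /(ge_inf (ex_intro _ e lbP)).
  have : inf P <= q by apply: ge_inf => //; exists e.
  by lra.
have mult t : 0 <= t -> is_period t -> t = (Num.truncn (t / p))%:R * p.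
  move=> t0 gt; have /andP[m0 mp] := truncn_mod p0 t0.
  move: m0; rewrite le_eqVlt => /orP[/eqP|m0]; first by lra.
  have /pmin : P (t - (Num.truncn (t / p))%:R * p).
    by split => //; apply: is_periodB => //; exact: is_periodMn.
  by rewrite leNgt mp.
have gf' : is_period `|f|.
  by case: (ger0P f) => // _; exact: is_periodN.
have := mult _ (ltW P2pi.1) g2pi.
have := mult _ (normr_ge0 f) gf'.
set j := Num.truncn _; set k := Num.truncn _ => fE piE.
have pi0 := pi_gt0 R.
have sf' : sin `|f| != 0.
  by case: (ger0P f) => // _; rewrite sinN oppr_eq0.
move: piE; case: k => [|[|[|k]]] piE.
- by move: piE; rewrite mul0r; lra.
- have pE : p = 2 * pi by lra.
  by move: sf'; rewrite fE pE mulrA -natrM sin_natpi eqxx.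
- by move: sf'; rewrite fE (_ : p = pi) ?sin_natpi ?eqxx//; lra.
by exists k; rewrite piE mulrC mulKf ?pnatr_eq0.
Qed.

End periods.

(** * Symmetries of a planar set *)

Section plane.
Variable R : realType.
Implicit Types (A E : set 'rV[R]_2) (T : 'rV[R]_2 -> 'rV[R]_2).

Definition row2 (a b : R) : 'rV[R]_2 := \row_i [:: a; b]`_i.

Lemma row2_eta (x : 'rV[R]_2) : exists a b, x = row2 a b.
Proof.
exists (x 0 0), (x 0 1); apply/rowP => -[[|[|//]] i2]; rewrite mxE/=;
  congr (x _ _); exact: val_inj.
Qed.

Lemma row2_inj a b a' b' : row2 a b = row2 a' b' -> a = a' /\ b = b'.
Proof.
by move=> /rowP ab; have := ab 0; have := ab 1; rewrite !mxE.
Qed.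

Lemma row2D a b a' b' : row2 a b + row2 a' b' = row2 (a + a') (b + b').
Proof. by apply/rowP => -[[|[|//]] i2]; rewrite !mxE. Qed.

Lemma row2N a b : - row2 a b = row2 (- a) (- b).
Proof. by apply/rowP => -[[|[|//]] i2]; rewrite !mxE. Qed.

Lemma row20 : row2 0 0 = 0.
Proof. by apply/rowP => -[[|[|//]] i2]; rewrite !mxE. Qed.

Lemma enorm_row2 a b : enorm (row2 a b) = Num.sqrt (a ^+ 2 + b ^+ 2).
Proof. by rewrite /enorm big_ord_recl big_ord1 !mxE. Qed.

Lemma enorm_row2_sqr a b : enorm (row2 a b) ^+ 2 = a ^+ 2 + b ^+ 2.
Proof. by rewrite enorm_row2 sqr_sqrtr// addr_ge0// sqr_ge0. Qed.

Lemma enorm_row2_le a b r : 0 <= r -> (enorm (row2 a b) <= r) = (a ^+ 2 +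
  b ^+ 2 <= r ^+ 2).
Proof.
move=> r0; rewrite -enorm_row2_sqr ler_pXn2r// nnegrE// enorm_row2.
exact: sqrtr_ge0.
Qed.

(** The images of the basis vectors, relative to [T 0], are orthonormal, and [d] is their
    determinant. The image of any other point is then fixed by its distances to these three
    images. *)
Lemma isometry_plane T : ISO T -> exists c s d b1 b2, [/\ c ^+ 2 + s ^+ 2 = 1,
  d ^+ 2 = 1 &
  forall x y, T (row2 x y) = row2 (c * x - d * s * y + b1) (s * x + d * c * y + b2)].
Proof.
move=> isoT.
have iso x y x' y' u v u' v' : T (row2 x y) = row2 u v -> T (row2 x' y') = row2 u' v' ->
    (u - u') ^+ 2 + (v - v') ^+ 2 = (x - x') ^+ 2 + (y - y') ^+ 2.
  move=> Tx Tx'; rewrite -!enorm_row2_sqr; congr (_ ^+ 2).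
  by have := isoT (row2 x y) (row2 x' y'); rewrite Tx Tx' !row2N !row2D.
have [b1 [b2 Tb]] := row2_eta (T (row2 0 0)).
have [p1 [q1 Te1]] := row2_eta (T (row2 1 0)).
have [p2 [q2 Te2]] := row2_eta (T (row2 0 1)).
pose c := p1 - b1; pose s := q1 - b2; pose g := p2 - b1; pose h := q2 - b2.
have cs : c ^+ 2 + s ^+ 2 = 1 by have := iso _ _ _ _ _ _ _ _ Te1 Tb; rewrite /c /s; lra.
have gh : g ^+ 2 + h ^+ 2 = 1 by have := iso _ _ _ _ _ _ _ _ Te2 Tb; rewrite /g /h; lra.
have cg : c * g + s * h = 0.
  by have := iso _ _ _ _ _ _ _ _ Te2 Te1; move: cs gh; rewrite /c /s /g /h; nra.
pose d := c * h - s * g.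
have gE : g = - (d * s).
  by apply: (@eq_of_lincomb2 _ (- g) _ _ c _ _ _ _ cs cg); rewrite /d; ring.
have hE : h = d * c.
  by apply: (@eq_of_lincomb2 _ (- h) _ _ s _ _ _ _ cs cg); rewrite /d; ring.
have d2 : d ^+ 2 = 1.
  apply: (@eq_of_lincomb3 _ (c ^+ 2 + s ^+ 2) _ _ 1 _ _ (- (c * g +
    s * h)) _ _ _ _ gh cs cg).
  by rewrite /d; ring.
exists c, s, d, b1, b2; split => // x y.
have [u [v Tx]] := row2_eta (T (row2 x y)).
have e0 := iso _ _ _ _ _ _ _ _ Tx Tb.
have e1 : c * (u - b1) + s * (v - b2) = x.
  by have := iso _ _ _ _ _ _ _ _ Tx Te1; move: cs e0; rewrite /c /s; nra.
have e2 : - d * s * (u - b1) + d * c * (v - b2) = y.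
  rewrite mulNr -gE -hE.
  by have := iso _ _ _ _ _ _ _ _ Tx Te2; move: gh e0; rewrite /g /h; nra.
rewrite Tx; congr row2.
- apply/esym; apply: (@eq_of_lincomb3 _ (u - b1) _ _ (- c) _ _ (d * s) _ _ _ _ cs
  e1 e2).
  apply: (@eq_of_lincomb2 _ (s ^+ 2 * (u - b1) - c * s * (v - b2)) _ _ 0 _ _ _ _ d2 d2).
  by ring.
- apply/esym; apply: (@eq_of_lincomb3 _ (v - b2) _ _ (- s) _ _ (- d * c) _ _ _ _ cs
  e1 e2).
  apply: (@eq_of_lincomb2 _ (c ^+ 2 * (v - b2) - c * s * (u - b1)) _ _ 0 _ _ _ _ d2 d2).
  by ring.
Qed.

(* If T is the isometry, the parallelogram law for T y and T (- y) bounds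
   |y|^2 + |T 0|^2 by the supremum of |y|^2 over A. *)
Lemma bounded_symmetric_fixes_origin A c s d b1 b2 :
    A (row2 0 0) ->
    (exists M, forall x y, A (row2 x y) -> x ^+ 2 + y ^+ 2 <= M) ->
    (forall x y t, A (row2 x y) -> 0 <= t < 1 ->
      A (row2 (t * x) (t * y)) /\ A (row2 (- (t * x)) (- (t * y)))) ->
    c ^+ 2 + s ^+ 2 = 1 -> d ^+ 2 = 1 ->
    (forall x y, A (row2 x y) -> A (row2 (c * x - d * s * y + b1) (s * x +
      d * c * y + b2))) ->
  b1 = 0 /\ b2 = 0.
Proof.
move=> A0 [M AM] Asym cs d2 AT.
pose S := [set r | exists x y, A (row2 x y) /\ r = x ^+ 2 + y ^+ 2].
have supS : has_sup S.
  split; first by exists (0 ^+ 2 + 0 ^+ 2), 0, 0.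
  by exists M => r [x [y [Axy ->]]]; exact: AM.
have leS x y : A (row2 x y) -> x ^+ 2 + y ^+ 2 <= sup S.
  by move=> Axy; apply: ub_le_sup; [exact: supS.2|exists x, y].
suff : sup S <= sup S - (b1 ^+ 2 + b2 ^+ 2).
  move=> b0; have : b1 ^+ 2 + b2 ^+ 2 = 0.
    by apply/le_anti; rewrite addr_ge0 ?sqr_ge0// andbT; lra.
  by move/eqP; rewrite paddr_eq0 ?sqr_ge0// !sqrf_eq0 => /andP[/eqP-> /eqP->].
apply: ge_sup => [|_ [x [y [Axy ->]]]]; first exact: supS.1.
(* Only a shrunk point is known to lie in [A] together with its opposite; boundary points need
   not. *)
have le t : 0 <= t < 1 -> t ^+ 2 * (x ^+ 2 + y ^+ 2) <= sup S - (b1 ^+ 2 + b2 ^+ 2).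
  move=> t01; have [/AT/leS + /AT/leS] := Asym _ _ _ Axy t01.
  set u := (X in X <= _ -> _ -> _); set v := (X in _ -> X <= _ -> _) => uS vS.
  suff : u + v = 2 * (t ^+ 2 * (x ^+ 2 + y ^+ 2) + (b1 ^+ 2 + b2 ^+ 2)) by lra.
  apply: (@eq_of_lincomb2 _ (2 * t ^+ 2 * (x ^+ 2 + d ^+ 2 * y ^+ 2)) _ _
    (2 * t ^+ 2 * y ^+ 2) _ _ _ _ cs d2).
  by rewrite /u /v; ring.
rewrite leNgt; apply/negP => lt.
set N := x ^+ 2 + y ^+ 2 in le lt; set B := sup S - _ in le lt.
have N0 : 0 <= N by rewrite addr_ge0// sqr_ge0.
have B0 : 0 <= B by have := le 0; rewrite expr0n mul0r lexx ltr01; apply.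
(* [t N] is the mean of [B] and [N], so [t^2 N > B] by the inequality of arithmetic and geometric
   means, strict as [B < N]. *)
pose t := (B + N) / (2 * N).
have NN : 0 < N by lra.
have tN : t * (2 * N) = B + N by rewrite /t divfK// mulf_neq0// lt0r_neq0.
have t0 : 0 <= t by rewrite divr_ge0; lra.
have t1 : t < 1 by rewrite ltr_pdivrMr; lra.
have := le t; rewrite t0 t1 => /(_ isT).
nra.
Qed.

(* Otherwise the symmetries of A are among 1, -1, S, - S for some reflection S,
   which all preserve the image of the unit disc under 2 + S, an ellipse with
   semi-axes 1 and 3. *)
Lemma complete_group_rotation A :
    complete_group (Sym A) ->
    (forall c s d b1 b2, c ^+ 2 + s ^+ 2 = 1 -> d ^+ 2 = 1 ->
       (forall x y, A (row2 x y) -> A (row2 (c * x - d * s * y + b1) (s * x +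
         d * c * y + b2))) ->
       b1 = 0 /\ b2 = 0) ->
  exists c s, [/\ c ^+ 2 + s ^+ 2 = 1, s != 0 &
    forall x y, A (row2 (c * x - s * y) (s * x + c * y)) <-> A (row2 x y)].
Proof.
move=> complA fix0; apply: contrapT => norot.
have SymP T : Sym A T -> exists c s d, [/\ c ^+ 2 + s ^+ 2 = 1, d ^+ 2 = 1,
   (forall x y, T (row2 x y) = row2 (c * x - d * s * y) (s * x + d * c * y)) &
   forall x y, A (row2 (c * x - d * s * y) (s * x + d * c * y)) <-> A (row2 x y)].
  move=> [isoT TA]; have [c [s [d [b1 [b2 [cs d2 TE]]]]]] := isometry_plane isoT.
  have AT x y : A (row2 x y) -> A (row2 (c * x - d * s * y + b1) (s * x +
    d * c * y + b2)).
    by move=> Axy; rewrite -TE -TA; exists (row2 x y).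
  have [b10 b20] := fix0 _ _ _ _ _ cs d2 AT.
  have {}TE x y : T (row2 x y) = row2 (c * x - d * s * y) (s * x + d * c * y).
    by rewrite TE b10 b20 !addr0.
  exists c, s, d; split => // x y; split; last by move=> /AT; rewrite b10 b20 !addr0.
  (* An isometry is injective, so the preimage [z] is the point itself. *)
  rewrite -TE => ATxy; have [z Az Tz] : (T @` A) (T (row2 x y)) by rewrite TA.
  have : enorm (T z - T (row2 x y)) =
    0 by rewrite Tz subrr -row20 enorm_row2 expr0n addr0 sqrtr0.
  have [z1 [z2 zE]] := row2_eta z.
  rewrite isoT zE row2N row2D => /(congr1 (fun x => x ^+ 2)).
  rewrite enorm_row2_sqr expr0n /= => /eqP;
    rewrite paddr_eq0 ?sqr_ge0// !sqrf_eq0 !subr_eq0.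
  by move=> /andP[/eqP z1x /eqP z2y]; rewrite -z1x -z2y -zE.
have norot' c s : c ^+ 2 + s ^+ 2 = 1 ->
    (forall x y, A (row2 (c * x - s * y) (s * x + c * y)) <-> A (row2 x y)) -> s = 0.
  by move=> cs rot; apply/eqP/negP => s0; apply: norot; exists c, s; split => //;
    apply/negP.
(* If some reflection preserves [A], it serves as [S]; otherwise only the two signs remain and any
   reflection will do. *)
have [c0 [s0 [cs0 SymE]]] : exists c0 s0, c0 ^+ 2 + s0 ^+ 2 = 1 /\
  forall T, Sym A T -> exists e, e ^+ 2 = 1 /\
    ((forall x y, T (row2 x y) = row2 (e * x) (e * y)) \/
     (forall x y, T (row2 x y) = row2 (e * (c0 * x + s0 * y)) (e * (s0 * x - c0 * y)))).
  have [[c0 [s0 [cs0 refl0]]]|norefl] := pselect (exists c s, c ^+ 2 + s ^+ 2 = 1 /\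
      forall x y, A (row2 (c * x + s * y) (s * x - c * y)) <-> A (row2 x y)).
    exists c0, s0; split => // T /SymP[c [s [d [cs d2 TE AT]]]].
    move/eqP : d2; rewrite sqrf_eq1 => /orP[/eqP d1|/eqP d1]; rewrite d1 in TE AT.
      have s0' : s = 0.
        by apply: (norot' c) => // x y; have := AT x y; rewrite !mul1r.
      exists c; split; first by rewrite -cs s0' expr0n addr0.
      by left => x y; rewrite TE s0'; congr row2; ring.
    (* [e] and [f] are the cosine and sine of the rotation obtained by composing [T] with [S]; it
       preserves [A], hence [f = 0]. *)
    pose e := c * c0 + s * s0; pose f := s * c0 - c * s0.
    have ef : e ^+ 2 + f ^+ 2 = 1.
      apply: (@eq_of_lincomb2 _ (c0 ^+ 2 + s0 ^+ 2) _ _ 1 _ _ _ _ cs cs0).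
      by rewrite /e /f; ring.
    have f0 : f = 0.
      apply: (norot' e) => // x y.
      suff -> : row2 (e * x - f * y) (f * x + e * y) =
          row2 (c * (c0 * x + s0 * y) - -1 * s * (s0 * x - c0 * y))
            (s * (c0 * x + s0 * y) + -1 * c * (s0 * x - c0 * y)).
        by rewrite AT refl0.
      by congr row2; rewrite /e /f; ring.
    exists e; split; first by rewrite -ef f0 expr0n addr0.
    have ce : c = e * c0.
      by apply: (@eq_of_lincomb2 _ (- c) _ _ (- s0) _ _ _ _ cs0 f0); rewrite /e /f;
        ring.
    have se : s = e * s0.
      by apply: (@eq_of_lincomb2 _ (- s) _ _ c0 _ _ _ _ cs0 f0); rewrite /e /f; ring.
    by right => x y; rewrite TE ce se; congr row2; ring.
  exists 1, 0; split; first by rewrite expr1n expr0n addr0.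
  move=> T /SymP[c [s [d [cs d2 TE AT]]]].
  move/eqP : d2; rewrite sqrf_eq1 => /orP[/eqP d1|/eqP d1]; rewrite d1 in TE AT.
    have s0' : s = 0.
      by apply: (norot' c) => // x y; have := AT x y; rewrite !mul1r.
    exists c; split; first by rewrite -cs s0' expr0n addr0.
    by left => x y; rewrite TE s0'; congr row2; ring.
  exfalso; apply: norefl; exists c, s; split => // x y; apply: iff_trans (AT x y).
  suff -> : row2 (c * x + s * y) (s * x - c * y) =
    row2 (c * x - -1 * s * y) (s * x + -1 * c * y) by [].
  by congr row2; ring.
(* [M = 2 + S] has inverse [M' = (2 - S) / 3], because [S] squares to 1. *)
pose M : 'M[R]_2 := \matrix_(i, j) (nth [::] [:: [:: 2 + c0; s0]; [:: s0;
  2 - c0]] i)`_j.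
pose M' : 'M[R]_2 := \matrix_(i, j)
  (nth [::] [:: [:: (2 - c0) / 3; - s0 / 3]; [:: - s0 / 3; (2 + c0) / 3]] i)`_j.
have MM' : M *m M' = 1%:M.
  apply/matrixP => -[[|[|//]] i2] -[[|[|//]] j2];
    rewrite !mxE big_ord_recl big_ord1 !mxE /=.
  - by apply: (@eq_of_lincomb2 _ (- (1 / 3)) _ _ 0 _ _ _ _ cs0 cs0); field.
  - by field.
  - by field.
  - by apply: (@eq_of_lincomb2 _ (- (1 / 3)) _ _ 0 _ _ _ _ cs0 cs0); field.
have [Munit _] := mulmx1_unit MM'.
have rowM x y : row2 x y *m M = row2 ((2 + c0) * x + s0 * y) (s0 * x + (2 - c0) * y).
  by apply/rowP => -[[|[|//]] i2]; rewrite !mxE big_ord_recl big_ord1 !mxE /=; ring.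
pose E := [set 0 + x *m M | x in closed_eball (0 : 'rV[R]_2) 1].
have EP u v : E (row2 u v) <-> exists x y, [/\ x ^+ 2 + y ^+ 2 <= 1,
    u = (2 + c0) * x + s0 * y & v = s0 * x + (2 - c0) * y].
  split.
    move=> [z]; have [x [y ->]] := row2_eta z.
    rewrite /closed_eball/= subr0 enorm_row2_le// expr1n add0r rowM =>
      xy /row2_inj[<- <-].
    by exists x, y.
  move=> [x [y [xy -> ->]]]; exists (row2 x y); last by rewrite add0r rowM.
  by rewrite /closed_eball/= subr0 enorm_row2_le// expr1n.
have [ctr [r [r0 Eball]]] : euclidean_ball E.
  apply: complA; first by exists 0, M.
  move=> T ST; have [isoT _] := ST; split => //.
  have [e [e2 Te]] := SymE _ ST.
  have TEE z : E z -> E (T z).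
    have [u [v ->]] := row2_eta z => /EP[x [y [xy -> ->]]].
    case: Te => ->; apply/EP.
      exists (e * x), (e * y); split; [|ring|ring].
      by rewrite !exprMn e2 !mul1r.
    exists (e * (c0 * x + s0 * y)), (e * (s0 * x - c0 * y)); split.
    - suff -> : (e * (c0 * x + s0 * y)) ^+ 2 +
      (e * (s0 * x - c0 * y)) ^+ 2 = x ^+ 2 + y ^+ 2.
        by [].
      by apply: (@eq_of_lincomb2 _ ((c0 ^+ 2 + s0 ^+ 2) * (x ^+ 2 + y ^+ 2)) _ _
        (x ^+ 2 + y ^+ 2) _ _ _ _ e2 cs0); ring.
    - by ring.
    - by ring.
  (* As [T] is an involution, mapping [E] into itself suffices for [T E = E]. *)
  have TT z : T (T z) = z.
    have [u [v ->]] := row2_eta z.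
    case: Te => H; rewrite !H; congr row2.
    - by rewrite mulrA -expr2 e2 mul1r.
    - by rewrite mulrA -expr2 e2 mul1r.
    - by apply: (@eq_of_lincomb2 _ ((c0 ^+ 2 + s0 ^+ 2) * u) _ _ u _ _ _ _ e2 cs0);
      ring.
    - by apply: (@eq_of_lincomb2 _ ((c0 ^+ 2 + s0 ^+ 2) * v) _ _ v _ _ _ _ e2 cs0);
      ring.
  apply/seteqP; split => [_ [z Ez <-]|z Ez]; first exact: TEE.
  by exists (T z) => //; exact: TEE.
have [p [q ctrE]] := row2_eta ctr.
have ballP u v : (u - p) ^+ 2 + (v - q) ^+ 2 <= r ^+ 2 <-> E (row2 u v).
  by rewrite Eball /closed_eball/= ctrE row2N row2D enorm_row2_le// ltW.
have r2 : 0 < r ^+ 2 by rewrite exprn_gt0.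
(* Both [E] and its opposite are used, so the unknown centre [(p, q)] cancels. Images of unit
   vectors have length at most [r], and conversely [2 - S] maps vectors of length [r] to vectors of
   length at most 3. *)
have lower x y u v : u = (2 + c0) * x + s0 * y -> v = s0 * x + (2 - c0) * y ->
    x ^+ 2 + y ^+ 2 = 1 -> u ^+ 2 + v ^+ 2 <= r ^+ 2.
  move=> uE vE xy.
  have /ballP : E (row2 u v) by apply/EP; exists x, y; rewrite xy.
  have /ballP : E (row2 (- u) (- v)).
    by apply/EP; exists (- x), (- y); split; [rewrite !sqrrN xy|rewrite uE;
      ring|rewrite vE; ring].
  by have := sqr_ge0 p; have := sqr_ge0 q; lra.
have upper u v : u ^+ 2 + v ^+ 2 = r ^+ 2 ->
    ((2 - c0) * u - s0 * v) ^+ 2 + ((2 + c0) * v - s0 * u) ^+ 2 <= 9.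
  move=> uv.
  have /ballP/EP[x [y [xy Eu Ev]]] : (p + u - p) ^+ 2 + (q +
    v - q) ^+ 2 <= r ^+ 2 by lra.
  have /ballP/EP[x' [y' [xy' Eu' Ev']]] : (p - u - p) ^+ 2 +
    (q - v - q) ^+ 2 <= r ^+ 2 by lra.
  have -> : (2 - c0) * u - s0 * v = 3 * ((x - x') / 2).
    by apply: (@eq_of_lincomb3 _ ((x' - x) / 2) _ _ ((2 - c0) / 2) _ _ (- s0 / 2) _
      _ _ _ cs0
      (congr2 (fun a b => a - b) Eu Eu') (congr2 (fun a b => a - b) Ev Ev')); field.
  have -> : (2 + c0) * v - s0 * u = 3 * ((y - y') / 2).
    by apply: (@eq_of_lincomb3 _ ((y' - y) / 2) _ _ (- s0 / 2) _ _ ((2 +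
      c0) / 2) _ _ _ _ cs0
      (congr2 (fun a b => a - b) Eu Eu') (congr2 (fun a b => a - b) Ev Ev')); field.
  by have := sqr_ge0 (x + x'); have := sqr_ge0 (y + y'); lra.
have l1 := @lower 1 0 (2 + c0) s0.
have {}l1 : (2 + c0) ^+ 2 + s0 ^+ 2 <= r ^+ 2.
  by apply: l1; rewrite ?expr1n ?expr0n ?addr0//; ring.
have l2 : s0 ^+ 2 + (2 - c0) ^+ 2 <= r ^+ 2.
  by apply: (@lower 0 1); rewrite ?expr1n ?expr0n ?add0r//; ring.
have u1 : ((2 - c0) * r - s0 * 0) ^+ 2 + ((2 + c0) * 0 - s0 * r) ^+ 2 <= 9.
  by apply: upper; rewrite expr0n addr0.
have u2 : ((2 - c0) * 0 - s0 * r) ^+ 2 + ((2 + c0) * r - s0 * 0) ^+ 2 <= 9.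
  by apply: upper; rewrite expr0n add0r.
have {}u1 : r ^+ 2 * (5 - 4 * c0) <= 9.
  apply: le_trans u1; rewrite le_eqVlt; apply/orP; left; apply/eqP/esym.
  by apply: (@eq_of_lincomb2 _ (r ^+ 2) _ _ 0 _ _ _ _ cs0 cs0); ring.
have {}u2 : r ^+ 2 * (5 + 4 * c0) <= 9.
  apply: le_trans u2; rewrite le_eqVlt; apply/orP; left; apply/eqP/esym.
  by apply: (@eq_of_lincomb2 _ (r ^+ 2) _ _ 0 _ _ _ _ cs0 cs0); ring.
(* The lower bounds are [5 + 4 c0] and [5 - 4 c0], whence [r^2 >= 5]; adding the upper bounds gives
   [10 r^2 <= 18]. *)
by move: l1 l2; nra.
Qed.

End plane.

(** * Centroids on the line *)

Section moment_line.
Variable R : realType.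
Local Notation mu := (@lebesgue_measure R).

Let singleton (x : measurableTypeR R) : 1.-tuple (measurableTypeR R) := [tuple x].

Let measurable_singleton : measurable_fun setT singleton.
Proof.
apply: (measurable_cons (f := id) (g := fun=> [tuple])); first exact: measurable_id.
exact: measurable_cst.
Qed.

(** The measure on 1-tuples is the product of Lebesgue measure with the Dirac mass at the empty
    tuple. *)
Lemma lebesgue_tuple1 (A : set (1.-tuple (measurableTypeR R))) : measurable A ->
  lebesgue_tuple R 1 A = pushforward mu singleton A.
Proof.
move=> mA; rewrite /= /lebesgue_cons /pushforward /= /product_measure1.
transitivity (\int[mu]_x (\1_(singleton @^-1` A) x)%:E)%E.
  apply: eq_integral => x _ /=.
  rewrite diracE indicE /xsection. congr ((nat_of_bool _)%:R%:E).
  by apply/idP/idP; rewrite !inE /= ?inE.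
rewrite integral_indic ?setIT//.
by rewrite -[X in measurable X]setTI; exact: measurable_singleton.
Qed.

(** Positive and negative parts are transported separately, so that no integrability is required of
    the identity on [S]. *)
Lemma moment_line (S : set R) : measurable S ->
  moment [set x : 'rV[R]_1 | S (x 0 0)] 0 = (\int[mu]_(x in S) x%:E)%E.
Proof.
move=> mS; rewrite /moment.
have -> : @row_of_tuple R 1 @^-1` [set x | S (x 0 0)] = (fun t => tnth t ord0) @^-1` S.
  by apply/seteqP; split => t /=; rewrite /row_of_tuple mxE.
have mtnth : measurable_fun setT (fun t : 1.-tuple (measurableTypeR R) => tnth t ord0).
  exact: measurable_tnth.
have mD : measurable ((fun t : 1.-tuple (measurableTypeR R) => tnth t ord0) @^-1` S).
  by rewrite -[X in measurable X]setTI; exact: mtnth.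
rewrite (eq_measure_integral (pushforward mu singleton)); last first.
  by move=> A mA _; exact: lebesgue_tuple1.
have tnthE : (fun t : 1.-tuple (measurableTypeR R) =>
  (tnth t 0 : R)%:E) \o singleton = EFin.
  by apply/funext => x /=; rewrite tnth0.
rewrite integralE [RHS]integralE; congr (_ - _)%E.
- rewrite ge0_integral_pushforward//; last first.
    apply: measurable_realfun.measurable_funepos.
    by apply/measurable_realfun.measurable_EFinP; apply: measurable_funS mtnth.
  by rewrite -funepos_comp tnthE.
- rewrite ge0_integral_pushforward//; last first.
    apply: measurable_realfun.measurable_funeneg.
    by apply/measurable_realfun.measurable_EFinP; apply: measurable_funS mtnth.
  by rewrite -funeneg_comp tnthE.
Qed.

(** [S] agrees with the segment up to its two endpoints, a null set, so the integral is
    [(a^2 - b^2) / 2]. *)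
Lemma integral_id_symmetric (S : set R) (a b : R) : 0 < a -> 0 < b ->
    measurable S -> `]- b, a[ `<=` S -> S `<=` `[- b, a] ->
    (\int[mu]_(x in S) x%:E = 0)%E -> a = b.
Proof.
move=> a0 b0 mS loS upS S0.
pose N := [set - b; a].
have mN : measurable N by apply: measurableU; exact: measurable_set1.
have N0 : mu N = 0%E.
  by apply: countable_lebesgue_measure0; exact/finite_set_countable/finite_set2.
have ba : - b < a by lra.
have cid : {within `[- b, a], continuous (fun x : R => x)}.
  by apply: continuous_subspaceT => x; exact: cvg_id.
have int : mu.-integrable `[- b, a] (fun x : R => x%:E).
  by apply: continuous_compact_integrable => //; exact: segment_compact.
have eqN : S `\` N = `[- b, a] `\` N.
  apply/seteqP; split => x [Sx Nx]; split => //; first exact: upS.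
  apply: loS; move: Sx Nx; rewrite /= !in_itv/= => /andP[bx xa] /not_orP[xb xa'].
  by rewrite !lt_neqAle bx xa !andbT eq_sym; apply/andP; split; apply/eqP.
have : (\int[mu]_(x in `[(- b)%R, a]) x%:E = 0)%E.
  rewrite (@negligible_integral _ _ _ mu _ N)// -eqN -negligible_integral//.
  by apply: integrableS int.
have dF (x : R) : is_derive x 1 (fun x : R => x ^+ 2 / 2) x.
  by apply: is_derive_eq; rewrite scaler0 scaler0 add0r /GRing.scale/=; field.
have cF (x : R) : {for x, continuous (fun x : R => x ^+ 2 / 2)}.
  by apply/differentiable_continuous/derivable1_diffP; exact: ex_derive.
rewrite (@continuous_FTC2 _ _ (fun x => x ^+ 2 / 2))//.
- move=> [] H; have : (a - b) * (a + b) = 0 by rewrite -subr_sqr; lra.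
  by move/eqP; rewrite mulf_eq0 => /orP[|]; rewrite ?subr_eq0 => /eqP; lra.
- split.
  + by move=> x _; apply: ex_derive.
  + exact/cvg_at_right_filter/cF.
  + exact/cvg_at_left_filter/cF.
- by move=> x _; rewrite derive1E; exact: derive_val.
Qed.

End moment_line.

(** * Sections of star bodies *)

Section euclidean.
Variables (R : realType) (n : nat).
Implicit Types x y u v w : 'rV[R]_n.

Definition dot x y : R := \sum_(i < n) x 0 i * y 0 i.

Lemma dotC x y : dot x y = dot y x.
Proof. by apply: eq_bigr => i _; rewrite mulrC. Qed.

Lemma dotDl x y u : dot (x + y) u = dot x u + dot y u.
Proof. by rewrite /dot -big_split; apply: eq_bigr => i _ /=; rewrite mxE mulrDl. Qed.

Lemma dotZl a x u : dot (a *: x) u = a * dot x u.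
Proof. by rewrite /dot mulr_sumr; apply: eq_bigr => i _; rewrite mxE mulrA. Qed.

Lemma dotDr x y u : dot u (x + y) = dot u x + dot u y.
Proof. by rewrite dotC dotDl !(dotC u). Qed.

Lemma dotZr a x u : dot u (a *: x) = a * dot u x.
Proof. by rewrite dotC dotZl (dotC u). Qed.

Lemma enormE x : enorm x = Num.sqrt (dot x x).
Proof. by congr Num.sqrt; apply: eq_bigr => i _; rewrite expr2. Qed.

Lemma dot_ge0 x : 0 <= dot x x.
Proof. by apply: sumr_ge0 => i _; rewrite -expr2 sqr_ge0. Qed.

Lemma enorm_sqr x : enorm x ^+ 2 = dot x x.
Proof. by rewrite enormE sqr_sqrtr// dot_ge0. Qed.

Lemma enorm_ge0 x : 0 <= enorm x.
Proof. exact: sqrtr_ge0. Qed.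

Lemma dot_eq0 x : dot x x = 0 -> x = 0.
Proof.
move=> xx; apply/rowP => i; rewrite mxE; apply/eqP; rewrite -sqrf_eq0 expr2.
move/eqP : xx; rewrite psumr_eq0; last by move=> j _; rewrite -expr2 sqr_ge0.
by move=> /allP/(_ i); rewrite mem_index_enum => /(_ isT).
Qed.

Lemma enorm_gt0 x : x != 0 -> 0 < enorm x.
Proof.
move=> x0; rewrite lt_neqAle enorm_ge0 andbT eq_sym.
apply: contra_neq x0 => x0; apply: dot_eq0; by rewrite -enorm_sqr x0 expr0n.
Qed.

Lemma enormZ a x : enorm (a *: x) = `|a| * enorm x.
Proof. by rewrite !enormE dotZl dotZr mulrA -expr2 sqrtrM ?sqr_ge0// sqrtr_sqr. Qed.

Lemma unit_sphereP x : unit_sphere x <-> dot x x = 1.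
Proof.
rewrite /unit_sphere/=; split => [x1|x1]; first by rewrite -enorm_sqr x1 expr1n.
by rewrite enormE x1 sqrtr1.
Qed.

Lemma unit_sphere_normalize x : x != 0 -> unit_sphere ((enorm x)^-1 *: x).
Proof.
move=> /enorm_gt0 x0; rewrite /unit_sphere/= enormZ ger0_norm ?invr_ge0 ?enorm_ge0//.
by rewrite mulVf// lt0r_neq0.
Qed.

Lemma unit_sphereN x : unit_sphere x -> unit_sphere (- x).
Proof. by rewrite /unit_sphere/= -scaleN1r enormZ normrN1 mul1r. Qed.

(** The matrix with rows [x] and [y] has rank at most 2, hence a nonzero kernel. *)
Lemma exists_orthogonal_unit x y : (3 <= n)%N ->
  exists w, [/\ unit_sphere w, dot x w = 0 & dot y w = 0].
Proof.
move=> n3; pose A : 'M[R]_(2, n) := col_mx x y.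
have : kermx A^T != 0.
  rewrite -mxrank_eq0 mxrank_ker mxrank_tr -lt0n subn_gt0.
  exact: leq_ltn_trans (rank_leq_row A) n3.
move=> /rowV0Pn[v /sub_kermxP vA v0].
have vAE (z : 'rV[R]_n) : (z <= A)%MS -> dot z v = 0.
  move=> /submxP[D ->]; transitivity ((v *m (D *m A)^T) 0 0).
    by rewrite [RHS]mxE; apply: eq_bigr => i _; rewrite [X in _ = _ * X]mxE mulrC.
  by rewrite trmx_mul mulmxA vA mul0mx mxE.
exists ((enorm v)^-1 *: v); split; first exact: unit_sphere_normalize.
- rewrite dotZr vAE ?mulr0//; apply: submx_trans (addsmxSl x y) _.
  by rewrite addsmxE.
- rewrite dotZr vAE ?mulr0//; apply: submx_trans (addsmxSr x y) _.
  by rewrite addsmxE.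
Qed.

End euclidean.

(** The hypothesis on subspaces is applied to the row space of [B]; it has dimension [k] because [B]
    has the right inverse [B^T]. *)
Lemma section_rows (R : realType) (n : nat) (K : set 'rV[R]_n) (k : nat) (B :
  'M[R]_(k, n)) :
    (forall H : {vspace 'rV[R]_n}, completely_symmetric_section K H) ->
    B *m B^T = 1%:M ->
  completely_symmetric [set x : 'rV[R]_k | K (x *m B)].
Proof.
move=> secK BB; pose f := linfun (mulmxr B : 'rV[R]_k -> 'rV[R]_n).
have fE x : f x = x *m B by rewrite lfunE.
have dimf : \dim (limg f) = k.
  rewrite limg_dim_eq; first by rewrite dimvf /dim/= mul1n.
  apply/eqP; rewrite -subv0; apply/subvP => x;
    rewrite memv_cap memvf/= memv_ker memv0 fE => /eqP xB.
  by rewrite -[x]mulmx1 -BB mulmxA xB mul0mx.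
have memf x : x *m B \in limg f by rewrite -fE memv_img// memvf.
have := secK (limg f); rewrite /completely_symmetric_section /orthonormal_basis
  /section_in_basis.
have : forall x : 'rV[R]_k, [set y | y \in limg f] (x *m B) by move=> x /=.
have : forall i, row i B \in limg f by move=> i; rewrite rowE memf.
(* Generalising the subspace and then its dimension lets [\dim H] be replaced by [k], so [B] needs
   no cast. *)
move: (limg f) dimf {memf} => H.
move: (\dim H) => d dk; subst d => rB xB /(_ B (conj BB rB)).
rewrite (_ : [set x | _] = [set x | K (x *m B)])//.
by apply/seteqP; split => x /=; [case|split => //; exact: xB].
Qed.

(** * The radial function of a body with completely symmetric sections *)

Section radial.
Variables (R : realType) (n : nat) (K : set 'rV[R]_n).
Hypotheses (starK : star_shaped K) (radK : has_continuous_radial_function K).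
Hypothesis secK : forall H : {vspace 'rV[R]_n}, completely_symmetric_section K H.
Local Notation rho := (radial_function K).

Lemma star_body_origin : K 0.
Proof. by case: radK => /interior_subset. Qed.

Lemma radial_function_ge u t : unit_sphere u -> K (t *: u) -> t <= rho u.
Proof. by case: radK => _ ub _ /ub uK Ktu; apply: ub_le_sup. Qed.

Lemma radial_function_lt u t : unit_sphere u -> 0 <= t -> t < rho u -> K (t *: u).
Proof.
move=> u1 t0 tr; have supK : has_sup [set s | K (s *: u)].
  split; first by exists 0; rewrite /= scale0r; exact: star_body_origin.
  by case: radK => _ ub _; exact: ub.
have rt : 0 < rho u - t by rewrite subr_gt0.
have [s Ks] := sup_adherent rt supK.
rewrite opprB addrCA subrr addr0 => ts.
have s0 : 0 < s by apply: le_lt_trans ts.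
rewrite (_ : t *: u = (t / s) *: (s *: u)); last by rewrite scalerA divfK// lt0r_neq0.
apply: starK => //; first by rewrite divr_ge0// ltW.
by rewrite ler_pdivrMr// mul1r ltW.
Qed.

Lemma radial_function_gt0 u : unit_sphere u -> 0 < rho u.
Proof.
move=> u1; case: radK => K0 _ _.
have cu : t *: u @[t --> (0 : R)] --> (0 : 'rV[R]_n).
  have : t *: u @[t --> (0 : R)] --> (0 : R) *: u by apply: cvgZr_tmp; exact: cvg_id.
  by rewrite scale0r.
have /nbhs_ballP[e /= e0 Ke] := cu _ K0.
have : K ((e / 2) *: u).
  by apply: Ke; rewrite /ball/= sub0r normrN ger0_norm; lra.
by move=> /(radial_function_ge u1); lra.
Qed.

(** The section by the line of [u] is an interval with ends [- rho (- u)] and [rho u], and its first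
    moment vanishes. *)
Lemma radial_functionN u : unit_sphere u -> rho (- u) = rho u.
Proof.
move=> u1; have uu : u *m u^T = 1%:M.
  apply/matrixP => i j; rewrite !ord1 !mxE /=.
  by move/unit_sphereP : u1 => <-; apply: eq_bigr => k _; rewrite mxE.
have [[_ _ mom] _] := section_rows secK uu.
pose S := [set s : R | K (s *: u)].
have KE : [set x : 'rV[R]_1 | K (x *m u)] = [set x : 'rV[R]_1 | S (x 0 0)].
  have xu (x : 'rV[R]_1) : x *m u =
    x 0 0 *: u by rewrite {1}[x]mx11_scalar mul_scalar_mx.
  by apply/seteqP; split => x /=; rewrite xu.
have Nu1 := unit_sphereN u1.
have loS : `]- rho (- u), rho u[ `<=` S.
  move=> s /=; rewrite in_itv/= => /andP[sl su]; rewrite /S/=.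
  have [s0|s0] := leP 0 s; first exact: radial_function_lt.
  rewrite -[s]opprK scaleNr -scalerN; apply: radial_function_lt => //; lra.
have upS : S `<=` `[- rho (- u), rho u].
  move=> s /= Ks; rewrite in_itv/=; apply/andP; split; last exact: radial_function_ge.
  by rewrite lerNl; apply: radial_function_ge => //; rewrite scaleNr scalerN opprK.
have mS : measurable S.
  apply: measurable_realfun.is_interval_measurable => s t Ss St r /andP[sr rt].
  have /= := upS _ Ss; have /= := upS _ St;
    rewrite !in_itv/= => /andP[_ tu] /andP[ls _].
  have [r0|r0] := leP 0 r.
    move: sr rt; rewrite le_eqVlt => /orP[/eqP<-//|_];
      rewrite le_eqVlt => /orP[/eqP->//|rt].
    by apply: loS; rewrite /= in_itv/=; apply/andP; split;
      have := radial_function_gt0 Nu1; lra.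
  move: sr rt; rewrite le_eqVlt => /orP[/eqP<-//|sr];
    rewrite le_eqVlt => /orP[/eqP->//|_].
  by apply: loS; rewrite /= in_itv/=; apply/andP; split;
    have := radial_function_gt0 u1; lra.
apply/esym/(integral_id_symmetric _ _ mS loS upS); [exact: radial_function_gt0..|].
by have := mom 0; rewrite KE moment_line// mxE mul0e.
Qed.

Lemma continuous_radial_comp (T : topologicalType) (t : T) (h : T -> 'rV[R]_n) :
    {for t, continuous h} -> (\forall x \near t, unit_sphere (h x)) ->
  {for t, continuous (rho \o h)}.
Proof.
move=> ch ht; have h1 : unit_sphere (h t) by exact: nbhs_singleton ht.
case: radK => _ _ /subspace_continuousP/(_ _ h1) crho.
apply: cvg_comp crho => P /= /ch.
by rewrite /nbhs/= => hP; apply: filterS2 ht hP => x ? /(_ _); apply.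
Qed.

(** The planar section [A], read in the basis [U], [W], is bounded and symmetric up to its boundary,
    so its symmetries fix the origin. Completeness then yields a rotation preserving [A], with
    nonzero sine, and its angle is a period of [g]. *)
Lemma circle_radial_period U W : dot U U = 1 -> dot W W = 1 -> dot U W = 0 ->
  exists m : nat, is_period (fun t => rho (cos t *: U + sin t *: W)) (2 * pi / m.+3%:R).
Proof.
move=> UU WW UW; have WU : dot W U = 0 by rewrite dotC.
have dotUW a b : dot (a *: U + b *: W) (a *: U + b *: W) = a ^+ 2 + b ^+ 2.
  by rewrite !(dotDl, dotDr, dotZl, dotZr) UU WW UW WU; ring.
have circ t : unit_sphere (cos t *: U + sin t *: W).
  by apply/unit_sphereP; rewrite dotUW cos2Dsin2.
pose g t := rho (cos t *: U + sin t *: W).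
have circn (t : R) : \forall x \near t, unit_sphere (cos x *: U + sin x *: W).
  by apply: (@filterE _ (nbhs t)) => x; exact: circ.
have cg : continuous g.
  move=> t; apply: (@continuous_radial_comp _ t (fun t =>
    cos t *: U + sin t *: W)) => //.
  by apply: cvgD; apply: cvgZr_tmp; [exact: continuous_cos|exact: continuous_sin].
pose B : 'M[R]_(2, n) := col_mx U W.
have BE a b : row2 a b *m B = a *: U + b *: W.
  apply/rowP => i; rewrite !mxE big_ord_recl big_ord1 !mxE /=.
  congr (_ * _ + _ * _); first by case: splitP => [j _|j]; rewrite ord1.
  case: splitP => [j|j _]; last by rewrite ord1.
  by rewrite [X in _ = X -> _](_ : _ = 0%N) ?ord1// => /eqP.
have BB : B *m B^T = 1%:M.
  apply/matrixP => i j.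
  have -> : (B *m B^T) i j = dot (row i B) (row j B).
    by rewrite !mxE; apply: eq_bigr => k _; rewrite !mxE.
  have BrowE (k : 'I_2) : row k B = (k == 0)%:R *: U + (k == 1)%:R *: W.
    rewrite -BE rowE; congr (_ *m _); apply/rowP => l; rewrite !mxE.
    by move: k l => -[[|[|//]] k2] -[[|[|//]] l2].
  rewrite !BrowE !(dotDl, dotDr, dotZl, dotZr) UU WW UW WU mxE.
  by move: i j => -[[|[|//]] i2] -[[|[|//]] j2] /=; ring.
have [_ complA] := section_rows secK BB.
set A := [set x | _] in complA.
have AE a b : A (row2 a b) = K (a *: U + b *: W) by rewrite /A/= BE.
have polar a b : 0 < a ^+ 2 + b ^+ 2 -> exists r t, [/\ - pi <= t <= pi, 0 < r,
    r ^+ 2 = a ^+ 2 + b ^+ 2 & a *: U + b *: W = r *: (cos t *: U + sin t *: W)].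
  move=> /polar_coordinates[r [t [r0 tpi -> ->]]]; exists r, t; split => //.
    by rewrite !exprMn -mulrDr cos2Dsin2 mulr1.
  by rewrite scalerDr !scalerA.
have pi0 := pi_gt0 R.
have fix0 c s d b1 b2 : c ^+ 2 + s ^+ 2 = 1 -> d ^+ 2 = 1 ->
    (forall x y, A (row2 x y) -> A (row2 (c * x - d * s * y + b1) (s * x +
      d * c * y + b2))) ->
    b1 = 0 /\ b2 = 0.
  apply: bounded_symmetric_fixes_origin.
  - by rewrite AE !scale0r addr0; exact: star_body_origin.
  (* The section is bounded by the maximum of [rho] on the circle. *)
  - have [|t0 _ gmax] := @EVT_max R g (- pi) pi _ (continuous_subspaceT cg).
      by lra.
    exists (g t0 ^+ 2) => x y; rewrite AE => Kxy.
    have [->|xy0] := eqVneq (x ^+ 2 + y ^+ 2) 0; first exact: sqr_ge0.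
    have [|r [t [tpi r0 r2 xyE]]] := polar x y.
      by rewrite lt_neqAle eq_sym xy0 addr_ge0// sqr_ge0.
    rewrite -r2 ler_pXn2r// ?nnegrE ?(ltW r0)//; last first.
      exact/ltW/radial_function_gt0.
    have : g t <= g t0 by apply: gmax; rewrite in_itv.
    by apply: le_trans; apply: radial_function_ge; rewrite -?xyE.
  - move=> x y t; rewrite !AE => Kxy /andP[t0 t1].
    split; first by rewrite -!scalerA -scalerDr; apply: starK => //; exact: ltW.
    have [xy0|xy0] := eqVneq (x ^+ 2 + y ^+ 2) 0.
      move/eqP : xy0; rewrite paddr_eq0 ?sqr_ge0// !sqrf_eq0 => /andP[/eqP-> /eqP->].
      by rewrite mulr0 oppr0 !scale0r addr0; exact: star_body_origin.
    have [|r [a [_ r0 r2 xyE]]] := polar x y.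
      by rewrite lt_neqAle eq_sym xy0 addr_ge0// sqr_ge0.
    rewrite !scaleNr -!scalerA -opprD -scalerDr xyE scalerA -scalerN.
    apply: radial_function_lt; first exact/unit_sphereN/circ.
    + by rewrite mulr_ge0// ltW.
    + rewrite radial_functionN//.
      have : r <= g a by apply: radial_function_ge; rewrite -?xyE.
      by apply: lt_le_trans; rewrite -[ltRHS]mul1r ltr_pM2r.
have [c [s [cs s0 Arot]]] := complete_group_rotation complA fix0.
have [f [_ cE sE]] := unit_cos_sin cs.
apply: (@primitive_period R g cg).
  by move=> t; rewrite /g mulr_natl cosD2pi sinD2pi.
exists f; first by rewrite -sE.
move=> t; rewrite /g /radial_function; congr sup; apply/seteqP; split => x /=.
- rewrite !scalerDr !scalerA -!AE cosD sinD -cE -sE => Ax; apply/Arot.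
  by move: Ax; congr (A _); congr row2; ring.
- rewrite !scalerDr !scalerA -!AE cosD sinD -cE -sE => /Arot.
  by congr (A _); congr row2; ring.
Qed.

(** A third unit vector [p] completes [x] and [w] to a great 2-sphere, on which [x] and [w] are a
    quarter turn apart on one great circle. *)
Lemma radial_function_orthogonal x w : (3 <= n)%N ->
  unit_sphere x -> unit_sphere w -> dot x w = 0 -> rho x = rho w.
Proof.
move=> n3 /unit_sphereP xx /unit_sphereP ww xw.
have [p [/unit_sphereP pp xp wp]] := exists_orthogonal_unit x w n3.
have wx : dot w x = 0 by rewrite dotC.
have px : dot p x = 0 by rewrite dotC.
have pw : dot p w = 0 by rewrite dotC.
pose V a b c := a *: x + b *: w + c *: p.
have VV a b c a' b' c' : dot (V a b c) (V a' b' c') = a * a' + b * b' + c * c'.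
  by rewrite !(dotDl, dotDr, dotZl, dotZr) xx ww pp xw wx xp px wp pw; ring.
have enormV a b c : enorm (V a b c) = Num.sqrt (a ^+ 2 + b ^+ 2 + c ^+ 2).
  by rewrite enormE VV !expr2.
have V0 a b c : 0 < a ^+ 2 + b ^+ 2 + c ^+ 2 -> V a b c != 0.
  move=> abc; apply/eqP => V0; have := VV a b c a b c.
  by rewrite V0 /dot big1 => [|i _]; rewrite ?mxE ?mulr0//; nra.
have VZ k a b c : k *: V a b c = V (k * a) (k * b) (k * c).
  by rewrite /V !scalerDr !scalerA.
(* Normalising extends [rho] from this 2-sphere to a function invariant under positive scaling. *)
pose F a b c := rho ((enorm (V a b c))^-1 *: V a b c).
have F1 a b c : a ^+ 2 + b ^+ 2 + c ^+ 2 = 1 -> F a b c = rho (V a b c).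
  by move=> abc; rewrite /F enormV abc sqrtr1 invr1 scale1r.
have Fconst : forall t, F (cos t) (sin t) 0 = F 1 0 0.
  apply: periodic_great_circles_constant.
  - move=> a b c abc.
    have c1 : {for (a, b, c), continuous (fun q : R * R * R => q.1.1)}.
      by apply: (@continuous_comp _ _ _ fst fst); exact: cvg_fst.
    have c2 : {for (a, b, c), continuous (fun q : R * R * R => q.1.2)}.
      by apply: (@continuous_comp _ _ _ fst snd); [exact: cvg_fst|exact: cvg_snd].
    have c3 : {for (a, b, c), continuous (fun q : R * R * R => q.2)} by exact: cvg_snd.
    have cV : {for (a, b, c), continuous (fun q : R * R * R => V q.1.1 q.1.2 q.2)}.
      by apply: cvgD; [apply: cvgD|]; apply: cvgZr_tmp.
    have cN : {for (a, b, c), continuous (fun q : R * R * R =>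
      enorm (V q.1.1 q.1.2 q.2))}.
      rewrite (_ : (fun q => _) = fun q : R * R * R =>
        Num.sqrt (q.1.1 ^+ 2 + q.1.2 ^+ 2 + q.2 ^+ 2)); last first.
        by apply/funext => q; exact: enormV.
      apply: (@continuous_comp _ _ _ (fun q : R * R * R =>
        q.1.1 ^+ 2 + q.1.2 ^+ 2 + q.2 ^+ 2));
        last exact: sqrt_continuous.
      by apply: continuous_add; [apply: continuous_add|]; exact: continuous_sqr.
    apply: (@continuous_radial_comp _ (a, b, c) (fun q : R * R * R =>
      (enorm (V q.1.1 q.1.2 q.2))^-1 *: V q.1.1 q.1.2 q.2)).
      apply: cvgZ => //; apply: cvgV => //.
      by rewrite lt0r_neq0// enorm_gt0// V0.
    have : \forall q \near (a, b, c), 0 < enorm (V q.1.1 q.1.2 q.2).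
      by move/cvgr_gt : cN; apply; rewrite enorm_gt0// V0.
    apply: filterS => q q0; apply: unit_sphere_normalize.
    by apply/eqP => Vq; move: q0; rewrite Vq enormE /dot big1 ?sqrtr0 ?ltxx// =>
      i _; rewrite mxE mulr0.
  - move=> k a b c k0; rewrite /F -VZ enormZ scalerA gtr0_norm// invfM mulrAC.
    by rewrite mulVf ?mul1r// lt0r_neq0.
  - move=> u1 u2 u3 w1 w2 w3 uu vv uv.
    have [||| m per] := @circle_radial_period (V u1 u2 u3) (V w1 w2 w3).
    + by rewrite VV -!expr2.
    + by rewrite VV -!expr2.
    + by rewrite VV.
    exists m => th t.
    have FE s : F (cos s * u1 + sin s * w1) (cos s * u2 + sin s * w2) (cos s * u3 +
      sin s * w3) =
        rho (cos s *: V u1 u2 u3 + sin s *: V w1 w2 w3).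
      rewrite F1; last first.
        transitivity (cos s ^+ 2 * (u1 ^+ 2 + u2 ^+ 2 + u3 ^+ 2)
          + sin s ^+ 2 * (w1 ^+ 2 + w2 ^+ 2 + w3 ^+ 2)
          + 2 * cos s * sin s * (u1 * w1 + u2 * w2 + u3 * w3)); first by ring.
        by rewrite uu vv uv mulr0 addr0 !mulr1 cos2Dsin2.
      by congr rho; apply/rowP => i; rewrite !mxE; ring.
    by rewrite !FE; exact: per.
have := Fconst (pi / 2); rewrite cos_pihalf sin_pihalf !F1; last 2 first.
- by rewrite expr1n expr0n !addr0.
- by rewrite expr1n expr0n addr0 add0r.
by rewrite /V !scale0r !scale1r !addr0 add0r => ->.
Qed.

End radial.

(** * From a constant radial function to the ball *)

Unset Implicit Arguments.

(** The radial function does not determine which boundary points belong to [K], so [K] is enclosed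
    between the open and the closed ball, with equality to the latter when [K] is closed. *)
Theorem corollary1p5 (R : realType) (n : nat) (hn : (3 <= n)%N)
    (K : set 'rV[R]_n) (hK : star_body K)
    (hrho : has_continuous_radial_function K)
    (hsec : forall H : {vspace 'rV[R]_n}, completely_symmetric_section K H) :
  exists r : R,
    [/\ 0 < r,
        open_eball 0 r `<=` K,
        K `<=` closed_eball 0 r &
        closed K -> K = closed_eball 0 r].
Proof.
have [starK _] := hK.
have [x [x1 _ _]] := @exists_orthogonal_unit R n 0 0 hn.
pose r := radial_function K x.
have r0 : 0 < r by exact: radial_function_gt0.
have rhoE u : unit_sphere u -> radial_function K u = r.
  (* A unit vector orthogonal to both [x] and [u] links their values. *)
  move=> u1; have [w [w1 xw uw]] := exists_orthogonal_unit x u hn.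
  rewrite (radial_function_orthogonal starK hrho hsec hn u1 w1 uw).
  by rewrite -(radial_function_orthogonal starK hrho hsec hn x1 w1 xw).
have normalizeK (v : 'rV[R]_n) : v != 0 -> v = enorm v *: ((enorm v)^-1 *: v).
  by move=> v0; rewrite scalerA divff ?scale1r// lt0r_neq0// enorm_gt0.
have openK : open_eball 0 r `<=` K.
  move=> v; rewrite /open_eball/= subr0 => vr.
  have [->|v0] := eqVneq v 0; first exact: star_body_origin.
  rewrite (normalizeK _ v0); apply: radial_function_lt => //.
  - exact: unit_sphere_normalize.
  - exact: enorm_ge0.
  - by rewrite rhoE//; exact: unit_sphere_normalize.
have Kclosed : K `<=` closed_eball 0 r.
  move=> v Kv; rewrite /closed_eball/= subr0.
  have [->|v0] := eqVneq v 0; first by rewrite -(scale0r x) enormZ normr0 mul0r ltW.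
  have v1 := unit_sphere_normalize v0.
  by rewrite -(rhoE _ v1); apply: radial_function_ge => //; rewrite -normalizeK.
exists r; split => // clK; apply/seteqP; split => // v.
rewrite /closed_eball/= subr0 => vr.
(* A point of the closed ball is the limit of its multiples [t v] with [t < 1], which lie in the
   open ball. *)
have cv : t *: v @[t --> (1 : R)^'-] --> v.
  apply: cvg_at_left_filter.
  have : t *: v @[t --> (1 : R)] --> (1 : R) *: v by apply: cvgZr_tmp; exact: cvg_id.
  by rewrite scale1r.
apply: (closed_cvg (fun w => K w) clK _ _ cv).
near=> t; have t0 : 0 <= t by near: t; apply: nbhs_left_ge; exact: ltr01.
have t1 : t < 1 by near: t; exact: nbhs_left_lt.
apply: openK; rewrite /open_eball/= subr0 enormZ ger0_norm//.
apply: le_lt_trans (_ : t * r < r); first by rewrite ler_wpM2l.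
by rewrite -[ltRHS]mul1r ltr_pM2r.
Unshelve. all: by end_near.
Qed.
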